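(* Let $\alpha:(a,b)\to\mathbb{R}$ be strictly increasing, let $\beta_1,\beta_2\in \mathrm{BV}_{\rm loc}((a,b),\mathbb{R})$, and assume $\omega_1(x)\neq0$ and $\omega_2(x)\neq0$ for all $x\in(a,b)$. Let $u$ and $v$ be nontrivial real-valued balanced solutions on $(a,b)$ of $-d(dy/d\alpha)+y\,d\beta_1=0$ and $-d(dy/d\alpha)+y\,d\beta_2=0$, respectively. Let $s<t$ be consecutive points in $\mathcal{Z}_{(a,b)}(u)$. (1) If $u^-(s)u^+(s)<0$, $u^-(t)=0$, $\omega_1(s)>0$, and $d(\beta_1-\beta_2)$ is a positive measure on $[s,t)$, then $v$ changes sign in $[s,t)$. (2) If $u^+(s)=0$, $u^-(t)u^+(t)<0$, $\omega_1(t)>0$, and $d(\beta_1-\beta_2)$ is a positive measure on $(s,t]$, then $v$ changes sign in $(s,t]$. (3) If $u^-(s)u^+(s)<0$, $u^+(t)=0$, $\omega_1(s)>0$, $\omega_1(t)>0$, and $d(\beta_1-\beta_2)$ is a positive measure on $[s,t]$, then $v$ changes sign in $[s,t]$. (4) If $u^-(s)=0$, $u^-(t)u^+(t)<0$, $\omega_1(s)>0$, $\omega_1(t)>0$, and $d(\beta_1-\beta_2)$ is a positive measure on $[s,t]$, then $v$ changes sign in $[s,t]$. (5) If $u^-(s)u^+(s)<0$, $u^-(t)u^+(t)<0$, $\omega_1(s)>0$, $\omega_1(t)>0$, and $d(\beta_1-\beta_2)$ is a positive measure on $[s,t]$, then $v$ changes sign in $[s,t]$.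
   Context: Throughout $-\infty\le a<b\le\infty$. $\mathrm{BV}_{\rm loc}((a,b),\mathbb{C})$ (resp. $\mathrm{BV}_{\rm loc}((a,b),\mathbb{R})$) is the space of complex-valued (resp. real-valued) functions of locally bounded variation on $(a,b)$. For such $f$: $f^-(x)=\lim_{t\uparrow x}f(t)$, $f^+(x)=\lim_{t\downarrow x}f(t)$; $df$ is the locally finite complex Borel measure on $(a,b)$ generated by $f$ (so $df([x,y))=f^-(y)-f^-(x)$ for $x<y$ in $(a,b)$); $\Delta_{df}(x)=df(\{x\})=f^+(x)-f^-(x)$. For $h$ locally integrable with respect to the total variation of $df$, $h\,df$ is the measure with density $h$ with respect to $df$. ''Positive measure'' means nonnegative measure (possibly zero). For $j=1,2$, $\omega_j(x)=1-\tfrac14\Delta_{d\alpha}(x)\Delta_{d\beta_j}(x)$, $x\in(a,b)$. A function $f$ is balanced if $f\in \mathrm{BV}_{\rm loc}((a,b),\mathbb{C})$ and $f(x)=\tfrac12(f^-(x)+f^+(x))$ for all $x\in(a,b)$. A function $u$ is a balanced solution of $-d(dy/d\alpha)+y\,d\beta=0$ on $(a,b)$ if $u$ is balanced, $du\ll d\alpha$ (locally), the Radon–Nikodym derivative $du/d\alpha$ is balanced (i.e. has a balanced representative, which is then unique because $\alpha$ is strictly increasing, and $du/d\alpha$ denotes that representative), and $-d(du/d\alpha)+u\,d\beta=0$ as measures. Nontrivial means not identically zero. For $f\in \mathrm{BV}_{\rm loc}((a,b),\mathbb{R})$ and a subinterval $I\subset(a,b)$, $\mathcal{Z}_I(f)=\{x\in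 I: f^-(x)f^+(x)\le0\}$. Points $s<t$ of $\mathcal{Z}_{(a,b)}(u)$ are consecutive if $\mathcal{Z}_{(a,b)}(u)\cap(s,t)=\emptyset$. A nontrivial real-valued balanced solution $w$ changes sign at $x_0\in(a,b)$ if there is $\delta>0$ such that $w^-<0$ on $(x_0-\delta,x_0)$ and $w^+>0$ on $(x_0,x_0+\delta)$, or $w^->0$ on $(x_0-\delta,x_0)$ and $w^+<0$ on $(x_0,x_0+\delta)$. It changes sign in a subinterval $I$ of $(a,b)$ if it changes sign at some point of $I$. *)

(* Defs.v *)
From HB Require Import structures.
From mathcomp Require Import all_boot all_order all_algebra.
From mathcomp Require Import all_classical all_reals all_analysis.

Set Implicit Arguments.
Unset Strict Implicit.
Unset Printing Implicit Defensive.

Import Order.TTheory GRing.Theory Num.Def Num.Theory.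
Import numFieldNormedType.Exports.

Local Open Scope ring_scope.
Local Open Scope classical_set_scope.

(* Functions on the open interval (a, b), with a and b extended reals, are
   represented by total functions R -> R; every notion below only depends on
   their values at points of (a, b). *)

Section OneSidedLimits.
Context {R : realType}.
Implicit Types (f alpha beta : R -> R) (x : R).

Definition llim f x : R := lim (f t @[t --> x^'-]).
Definition rlim f x : R := lim (f t @[t --> x^'+]).

Definition jump f x : R := rlim f x - llim f x.

Definition omega alpha beta x : R := 1 - 4^-1 * jump alpha x * jump beta x.

End OneSidedLimits.

Section LocallyBoundedVariation.
Context {R : realType}.
Implicit Types (a b : \bar R) (c d : R) (f : R -> R).

Definition ointv a b : set R := [set x : R | (a < x%:E)%E /\ (x%:E < b)%E].

(* [c, d] is a nondegenerate compact subinterval of (a, b) *)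
Definition cptsub a b c d : Prop := [/\ (a < c%:E)%E, c < d & (d%:E < b)%E].

Definition BVloc a b f : Prop :=
  forall c d, cptsub a b c d -> bounded_variation c d f.

Definition balanced a b f : Prop :=
  BVloc a b f /\
  forall x, ointv a b x -> f x = 2^-1 * (llim f x + rlim f x).

End LocallyBoundedVariation.

(* The locally finite signed measure df is handled through its restrictions to
   the intervals [c, d) with [c, d] contained in (a, b); every relatively
   compact Borel subset of (a, b) lies in one of them.  Each restriction is a
   finite signed measure on R that does not charge the complement of [c, d). *)
Section StieltjesCharge.
Context {R : realType}.
Implicit Types (c d : R) (f : R -> R) (nu : {charge set R -> \bar R}).

Definition generated_by f c d nu : Prop :=
  (forall A, measurable A -> nu A = nu (A `&` `[c, d[)) /\
  (forall x y, c <= x -> x < y -> y <= d ->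
     nu `[x, y[ = (llim f y - llim f x)%:E).

Definition dmeas f c d : {charge set R -> \bar R} :=
  match pselect (exists nu, generated_by f c d nu) with
  | left h => projT1 (cid h)
  | right _ => czero
  end.

End StieltjesCharge.

Section StieltjesExistence.
Context {R : realType}.
Implicit Types (c d e x y z : R) (f : R -> R).

Section Nondecreasing.
Context (g : R -> R) (ndg : {homo g : x y / x <= y}).

Let cvgl x : g t @[t --> x^'-] --> llim g x.
Proof.
have : cvg (g t @[t --> x^'-]); last by [].
apply: nondecreasing_at_left_is_cvgr.
  by near=> z => p q _ _; exact: ndg.
near=> z; exists (g x) => r /= [t /=]; rewrite in_itv/= => /andP[_ tx] <-.
exact/ndg/ltW.
Unshelve. all: by end_near. Qed.

Let cvgr x : g t @[t --> x^'+] --> rlim g x.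
Proof.
have : cvg (g t @[t --> x^'+]); last by [].
apply: nondecreasing_at_right_is_cvgr.
  by near=> z => p q _ _; exact: ndg.
near=> z; exists (g x) => r /= [t /=]; rewrite in_itv/= => /andP[xt _] <-.
exact/ndg/ltW.
Unshelve. all: by end_near. Qed.

Let rlim_ge x : g x <= rlim g x.
Proof.
apply: limr_ge; first exact: (cvgP (rlim g x)).
by near=> t; exact/ndg/ltW.
Unshelve. all: by end_near. Qed.

Let rlim_le x y : x < y -> rlim g x <= g y.
Proof.
move=> xy; apply: limr_le; first exact: (cvgP (rlim g x)).
near=> t; apply/ndg.
by near: t; exact: nbhs_right_le.
Unshelve. all: by end_near. Qed.

Let llim_ge x y : x < y -> rlim g x <= llim g y.
Proof.
move=> xy; apply: limr_ge; first exact: (cvgP (llim g y)).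
near=> t; apply: rlim_le.
by near: t; exact: nbhs_left_gt.
Unshelve. all: by end_near. Qed.

Let nd_rlim : nondecreasing (rlim g).
Proof.
move=> x y; rewrite le_eqVlt => /predU1P[->//|xy].
exact: (le_trans (rlim_le xy)).
Qed.

Let rc_rlim : right_continuous (rlim g).
Proof.
move=> x; apply/cvgrPdist_le => e e0.
have /cvgrPdist_le/(_ _ e0) ge := @cvgr x.
near x^'+ => y.
have xy : x < y by near: y; exact: nbhs_right_gt.
have gy : `|rlim g x - g y| <= e by near: y; exact: ge.
near=> t.
have xt : x < t by near: t; exact: nbhs_right_gt.
have ty : t < y by near: t; exact: nbhs_right_lt.
have h1 := rlim_le ty; have h2 := nd_rlim (ltW xt).
rewrite ler0_norm ?subr_le0// opprB.
move: gy; rewrite ler0_norm ?subr_le0 ?rlim_le// opprB.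
by apply: le_trans; rewrite lerB.
Unshelve. all: by end_near. Qed.

Let G : cumulative R R :=
  HB.pack (rlim g) (isCumulative.Build R _ R (rlim g) nd_rlim rc_rlim).

Let mu : {measure set (measurableTypeR R) -> \bar R} :=
  lebesgue_stieltjes_measure G.

Let mu_oc x y : x <= y -> mu `]x, y] = (rlim g y - rlim g x)%:E.
Proof.
move=> xy; have -> : mu `]x, y] = wlength G `]x, y].
  by apply: measurable_mu_extE; exact: is_ocitv.
by rewrite wlength_itv_bnd.
Qed.

Let mu_oo x y : x < y -> mu `]x, y[ = (llim g y - rlim g x)%:E.
Proof.
move=> xy; have xy0 : 0 < y - x by rewrite subr_gt0.
pose u (n : nat) := y - (y - x) / n.+1%:R.
have u_lt n : u n < y by rewrite ltrBlDr ltrDl divr_gt0.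
have u_ge n : x <= u n.
  by rewrite lerBrDl -lerBrDr ler_pdivrMr// ler_peMr ?ler1n// ltW.
have uy : u n @[n --> \oo] --> y.
  rewrite -[X in _ --> X](subr0 y); apply: cvgB; first exact: cvg_cst.
  rewrite -[X in _ --> X](mulr0 (y - x)); apply: cvgM; first exact: cvg_cst.
  exact: cvg_harmonic.
have und : {homo u : n m / (n <= m)%N >-> n <= m}.
  move=> n m nm; rewrite lerB// ler_pM2l// lef_pV2 ?posrE//.
  by rewrite ler_nat.
pose F (n : nat) : set (measurableTypeR R) := `]x, u n].
have F_cup : \bigcup_n F n = `]x, y[.
  apply/seteqP; split=> [t [n _]|t]; rewrite /F/= !in_itv/=.
    by move=> /andP[-> /le_lt_trans]; exact.
  move=> /andP[xt ty]; have [N _ /(_ N)] := cvgr_gt _ uy _ ty.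
  move=> /(_ (leqnn _)) /= uN; exists N => //; rewrite /F/= in_itv/= xt.
  exact: ltW.
have : mu \o F @ \oo --> mu (\bigcup_n F n).
  apply: nondecreasing_cvg_mu.
  - by move=> n; exact: measurable_itv.
  - by rewrite F_cup; exact: measurable_itv.
  - move=> n m nm; apply/subsetPset => t; rewrite /F/= !in_itv/=.
    by move=> /andP[-> /le_trans]; apply; exact: und.
have -> : mu \o F = fun n => (rlim g (u n) - rlim g x)%:E.
  by apply/funext => n /=; rewrite mu_oc.
rewrite F_cup => /cvg_lim <-//; apply/cvg_lim => //.
apply: cvg_EFin; first by near=> n.
apply: cvgB; last exact: cvg_cst.
apply: (@squeeze_cvgr _ _ _ _ (g \o u) (fun=> llim g y)).
- by near=> n; rewrite rlim_ge/= llim_ge.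
- by move/cvg_at_leftP : (@cvgl y); apply.
- exact: cvg_cst.
Unshelve. all: by end_near. Qed.

Let mu_co x y : x < y -> mu `[x, y[ = (llim g y - llim g x)%:E.
Proof.
move=> xy; have [z zx] : exists z, z < x by exists (x - 1); rewrite ltrBlDr ltrDl.
have : mu `]z, y[ = (mu `]z, x[ + mu `[x, y[)%E.
  rewrite -measureU//; [|exact: measurable_itv..|].
  - congr (mu _); apply/seteqP; split=> t; rewrite /= !in_itv/=.
      move=> /andP[zt ty]; have [tx|xt] := ltP t x; first by left; rewrite zt.
      by right.
    move=> [/andP[-> /lt_trans]|/andP[xt ->]]; first exact.
    by rewrite (lt_le_trans zx).
  - rewrite -subset0 => t; rewrite /= !in_itv/= => -[/andP[_ tx] /andP[xt _]].
    by rewrite ltNge xt in tx.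
rewrite !mu_oo//; last exact: lt_trans xy.
case: (mu `[x, y[) => [r| |]//= [] /eqP; rewrite addrC -subr_eq => /eqP <-.
by rewrite opprB addrA subrK.
Qed.

Lemma nd_generated c d : c < d -> exists nu : {charge set R -> \bar R},
  (forall A, measurable A -> nu A = nu (A `&` `[c, d[)) /\
  (forall x y, c <= x -> x < y -> y <= d ->
     nu `[x, y[ = (llim g y - llim g x)%:E).
Proof.
move=> cd.
have mI : measurable (`[c, d[ : set (measurableTypeR R)).
  exact: measurable_itv.
have muI : (mu `[c, d[ < +oo)%E by rewrite mu_co// ltry.
pose nu : {charge set (measurableTypeR R) -> \bar R} :=
  charge_of_finite_measure (mfrestr mI muI).
(* R and measurableTypeR R have the same measurable sets but carry different
   displays, hence the repacking *)
pose nu' : set R -> \bar R := fun A => nu A.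
have nu'0 : nu' set0 = 0%E by exact: (charge0 nu).
have nu'fin A : measurable A -> nu' A \is a fin_num.
  by move=> mA; exact: (fin_num_measure nu).
have nu'add : semi_sigma_additive nu'.
  by move=> F mF tF mUF; exact: (@charge_semi_sigma_additive _ _ _ nu F mF tF mUF).
pose nuR : {charge set R -> \bar R} :=
  HB.pack nu' (isCharge.Build _ _ _ nu' nu'0 nu'fin nu'add).
exists nuR; rewrite /= /nuR/= /nu' /nu/= /charge_of_finite_measure/= /mfrestr/= /mrestr; split.
  by move=> A mA; rewrite -setIA setIid.
move=> x y cx xy yd; rewrite setIidl ?mu_co// => t; rewrite /= !in_itv/=.
by move=> /andP[xt ty]; rewrite (le_trans cx)//= (lt_le_trans ty).
Qed.

End Nondecreasing.

Lemma generated_exists f e c d : e < c -> c < d -> bounded_variation e d f ->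
  exists nu, generated_by f c d nu.
Proof.
move=> ec cd bv; have ed := lt_trans ec cd.
pose k x := Num.max e (Num.min x d).
have ek x : e <= k x by rewrite /k le_max lexx.
have kd x : k x <= d by rewrite /k ge_max ge_min lexx orbT (ltW ed).
have kE x : e <= x -> x <= d -> k x = x.
  by move=> ex xd; rewrite /k min_l// max_r.
have ndk x y : x <= y -> k x <= k y.
  by move=> xy; rewrite /k ge_max !le_max lexx/= le_min !ge_min xy lexx !orbT.
have fin x y : e <= x -> x <= y -> y <= d -> total_variation x y f \is a fin_num.
  move=> ex xy yd; apply/bounded_variationP => //.
  apply: (bounded_variationl _ yd) => //.
  exact: (bounded_variationr ex (le_trans xy yd)).
pose p x := fine (total_variation e (k x) f).
pose n x := p x - f (k x).
have pE x y : x <= y -> p y = p x + fine (total_variation (k x) (k y) f).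
  move=> xy; rewrite /p (total_variationD f (ek x) (ndk _ _ xy)) fineD//.
    exact: fin.
  by apply: fin => //; exact: ndk.
have ndp : {homo p : x y / x <= y}.
  move=> x y xy; rewrite (pE _ _ xy) lerDl fine_ge0//.
  exact/total_variation_ge0/ndk.
have ndn : {homo n : x y / x <= y}.
  move=> x y xy; rewrite /n (pE _ _ xy) lerBrDr addrAC -addrA lerD2l.
  rewrite (le_trans (ler_norm _))// addrC -lee_fin fineK; last first.
    by apply: fin => //; exact: ndk.
  by rewrite addrC; exact/total_variation_ge/ndk.
have [nup [pI pE']] := nd_generated ndp cd.
have [nun [nI nE']] := nd_generated ndn cd.
have llimE x : e < x -> x <= d -> llim f x = llim p x - llim n x.
  move=> ex xd; apply/cvg_lim => //.
  have cl g : {homo g : x y / x <= y} -> g t @[t --> x^'-] --> llim g x.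
    move=> ndg; have : cvg (g t @[t --> x^'-]); last by [].
    apply: nondecreasing_at_left_is_cvgr.
      by near=> z => s q _ _; exact: ndg.
    near=> z; exists (g x) => r /= [t /=]; rewrite in_itv/= => /andP[_ tx] <-.
    exact/ndg/ltW.
  apply: cvg_trans (cvgB (cl p ndp) (cl n ndn)); apply: near_eq_cvg.
  near=> t; rewrite !fctE /n opprB addrC subrK kE//.
    by near: t; exact: nbhs_left_ge.
  by apply: le_trans xd; near: t; exact: nbhs_left_le.
pose nu : {charge set R -> \bar R} := cadd nup (copp nun).
have nuE A : nu A = (nup A - nun A)%E by [].
exists nu; split.
  by move=> A mA; rewrite !nuE pI// nI.
move=> x y cx xy yd; rewrite nuE pE'// nE'//.
rewrite !llimE//; last 3 first.
- exact: lt_le_trans cx.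
- exact: le_trans (ltW xy) yd.
- by apply: lt_le_trans ec _; exact: le_trans (ltW xy).
rewrite -EFinN -EFinD; congr EFin.
by rewrite !opprB addrACA [RHS]addrACA; congr (_ + _); rewrite addrC.
Unshelve. all: by end_near. Qed.

Lemma dmeasP (a b : \bar R) f c d : BVloc a b f -> cptsub a b c d ->
  generated_by f c d (dmeas f c d).
Proof.
move=> bv [ac cd db].
rewrite /dmeas; case: pselect => [h|]; first exact: (projT2 (cid h)).
case.
have [e ae ec] : exists2 e, (a < e%:E)%E & e < c.
  have [m /andP[am mc]] : exists m : R, (a < m%:E < c%:E)%E.
    case: a ac {bv} => [r||]//= ac.
    - exists ((r + c) / 2); rewrite lte_fin in ac.
      by rewrite !lte_fin !midf_lt.
    - by exists (c - 1); rewrite ltNyr lte_fin ltrBlDr ltrDl ltr01.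
  by exists m.
apply: (generated_exists ec cd); apply: bv; split=> //.
exact: lt_trans cd.
Qed.

End StieltjesExistence.

(* Integration against a signed measure; by uniqueness of the Jordan
   decomposition the choice of the Hahn decomposition is immaterial. *)
Section ChargeIntegral.
Context {R : realType}.
Implicit Types (nu : {charge set R -> \bar R}) (h : R -> R) (A : set R).

Definition hahn_pos nu : set R := projT1 (cid (Hahn_decomposition nu)).
Definition hahn_neg nu : set R :=
  projT1 (cid (projT2 (cid (Hahn_decomposition nu)))).
Definition hahnP nu : hahn_decomposition nu (hahn_pos nu) (hahn_neg nu) :=
  projT2 (cid (projT2 (cid (Hahn_decomposition nu)))).

Definition charge_integrable nu A h : Prop :=
  (charge_variation (hahnP nu)).-integrable A (EFin \o h).

Definition charge_integral nu A h : \bar R :=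
  (\int[jordan_pos (hahnP nu)]_(x in A) (h x)%:E
   - \int[jordan_neg (hahnP nu)]_(x in A) (h x)%:E)%E.

End ChargeIntegral.

Section BalancedSolutions.
Context {R : realType}.
Implicit Types (a b : \bar R) (alpha beta f g h u : R -> R) (I : set R).

Definition loc_dominated a b f g : Prop :=
  forall c d, cptsub a b c d -> dmeas f c d `<< dmeas g c d.

Definition loc_integrable a b h f : Prop :=
  forall c d, cptsub a b c d -> charge_integrable (dmeas f c d) `[c, d[ h.

(* df = h dg as measures on (a, b) *)
Definition has_density a b f g h : Prop :=
  loc_integrable a b h g /\
  forall c d, cptsub a b c d -> forall A, measurable A -> A `<=` `[c, d[ ->
    dmeas f c d A = charge_integral (dmeas g c d) A h.

(* - df + h dg = 0 as measures on (a, b) *)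
Definition measure_eq0 a b f h g : Prop :=
  loc_integrable a b h g /\
  forall c d, cptsub a b c d -> forall A, measurable A -> A `<=` `[c, d[ ->
    (- dmeas f c d A + charge_integral (dmeas g c d) A h = 0)%E.

(* Real-valued balanced solutions of - d(dy/dalpha) + y dbeta = 0; g is the
   balanced representative of du/dalpha.  For real u and alpha it is real: it is
   so dalpha-almost everywhere, hence on a dense set, hence everywhere. *)
Definition balanced_solution a b alpha beta u : Prop :=
  [/\ balanced a b u, loc_dominated a b u alpha &
      exists g, [/\ balanced a b g, has_density a b u alpha g
                  & measure_eq0 a b g u beta]].

Definition nontrivial a b u : Prop := exists2 x, ointv a b x & u x != 0.

Definition positive_on a b f I : Prop :=
  forall c d, cptsub a b c d -> positive_set (dmeas f c d) I.

Definition zeros f I : set R := [set x | I x /\ llim f x * rlim f x <= 0].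

Definition consecutive_zeros a b f (s t : R) : Prop :=
  [/\ s < t, zeros f (ointv a b) s, zeros f (ointv a b) t
    & zeros f (ointv a b) `&` `]s, t[ = set0].

Definition changes_sign_at w (x0 : R) : Prop :=
  exists2 delta : R, 0 < delta &
    ((forall x, x0 - delta < x < x0 -> llim w x < 0) /\
     (forall x, x0 < x < x0 + delta -> 0 < rlim w x)) \/
    ((forall x, x0 - delta < x < x0 -> 0 < llim w x) /\
     (forall x, x0 < x < x0 + delta -> rlim w x < 0)).

Definition changes_sign_in w I : Prop := exists2 x0, I x0 & changes_sign_at w x0.

End BalancedSolutions.

(* Main.v *)
(* Let [g], [h] be the quasi-derivatives of [u], [v] and [W = u h - g v].  Since
   balanced functions obey the Leibniz rule, [dW = - u v d(beta1 - beta2)].  If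
   [v] did not change sign, then after normalising signs [u] and [v] would both
   be nonnegative between [s] and [t], so that [W^-(t) <= W^+(s)].  At a point
   where [u] switches from [u^- <= 0] to [u^+ > 0] while [v^-, v^+ >= 0], with
   [A, B1, B2] the jumps of [alpha, beta1, beta2],
     [W^+ = omega1 (u h - g v) - (B1 - B2) v u^+ / 2 <= 0],
   strictly if [u^- < 0]; symmetrically [W^-(t) >= 0], strictly if
   [u^-(t) u^+(t) < 0].  This is a contradiction as soon as one of the two
   endpoints is a strict sign change of [u].

   No integration by parts is needed: the increment of [W] over a short open
   interval is estimated through the one-sided oscillations of [u, g, v, h], and
   the local estimates are glued by induction on intervals. *)

Require Import Defs.
From HB Require Import structures.
From mathcomp Require Import all_boot all_order all_algebra.
From mathcomp Require Import all_classical all_reals all_analysis.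
From mathcomp Require Import ring lra.

Set Implicit Arguments.
Unset Strict Implicit.
Unset Printing Implicit Defensive.

Import Order.TTheory GRing.Theory Num.Theory.
Import numFieldNormedType.Exports.

Local Open Scope ring_scope.
Local Open Scope classical_set_scope.

(** * Integrals of nearly constant functions *)

Section ChargeIntegralBounds.
Context {R : realType}.

(** Only the masses of points and of open intervals matter. Each function is therefore replaced by
    its triple of values [fl], [fv], [fr], and each equation by the numerical system [solves]; the
    lemmas on charges serve to show that balanced solutions satisfy it.

    The obstacle is that a one-sided limit of a solution may vanish where no sign change occurs.
    Signs are therefore attached to the germs [pos_left] and [pos_right] beside a point. Such a
    germ, of the solution or of its opposite, is positive as soon as u and g do not both vanish at
    the point. The passage from (u, g) to (u^-, g^-) or (u^+, g^+) at a point has determinant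
    omega_j: if omega_j never vanishes, a common zero of u and g would spread to the left and to the
    right and make u trivial.

    An endpoint at which the inner limit of u vanishes is settled by g: if u^+(s) = 0 and u > 0 to
    the right of s, then g^+(s) >= 0, so W^+(s) = - g^+(s) v^+(s) <= 0 when v^+(s) >= 0. This is how
    s can be left out of the interval in (2), and symmetrically t in (1). Right endpoints follow
    from left ones by x -> -x. *)

Lemma integral_dist_cst_le (m : {finite_measure set R -> \bar R}) (A : set R)
    (h : R -> R) (k e : R) :
  measurable A -> measurable_fun A h -> (forall z, A z -> `|h z - k| <= e) ->
  (\int[m]_(x in A) (h x)%:E)%E \is a fin_num /\
  `|fine (\int[m]_(x in A) (h x)%:E)%E - k * fine (m A)| <= e * fine (m A).
Proof.
move=> mA mh hb.
have mAf : m A \is a fin_num by exact: fin_num_measure.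
have ih : m.-integrable A (EFin \o h).
  apply: measurable_bounded_integrable => //; first by rewrite ltey_eq mAf.
  exists (`|k| + `|e|); split=> // M kM x Ax /=; apply: ltW; apply: le_lt_trans kM.
  rewrite -[h x](subrK k) addrC (le_trans (ler_normD _ _))// lerD2l.
  exact: le_trans (hb _ Ax) (ler_norm _).
have If : (\int[m]_(x in A) (h x)%:E)%E \is a fin_num by exact: integrable_fin_num.
have ic r : m.-integrable A (EFin \o cst r).
  exact: finite_measure_integrable_cst.
have hk z : A z -> k - e <= h z <= k + e.
  by move=> Az; have := hb _ Az; rewrite ler_distl.
split=> //.
have up : (\int[m]_(x in A) (h x)%:E <= (k + e)%:E * m A)%E.
  rewrite -integral_cst//; apply: (le_integral mA ih (ic _)) => z.
  by rewrite inE => /hk /andP[_]; rewrite lee_fin.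
have lo : ((k - e)%:E * m A <= \int[m]_(x in A) (h x)%:E)%E.
  rewrite -integral_cst//; apply: (le_integral mA (ic _) ih) => z.
  by rewrite inE => /hk /andP[+ _]; rewrite lee_fin.
move: up lo; rewrite -(fineK If) -(fineK mAf) -!EFinM !lee_fin => up lo.
by rewrite ler_norml; apply/andP; split; lra.
Qed.

(** The errors on the two Jordan parts add up to the total variation. This estimate is the only
    property of the integral used later: with [e = 0] it evaluates point masses, with small [e] it
    controls short intervals. *)
Lemma charge_integral_dist_cst_le (nu : {charge set R -> \bar R}) (A : set R)
    (h : R -> R) (k e : R) :
  measurable A -> charge_integrable nu A h -> (forall z, A z -> `|h z - k| <= e) ->
  `|fine (charge_integral nu A h) - k * fine (nu A)|
    <= e * fine (charge_variation (hahnP nu) A).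
Proof.
move=> mA /measurable_int/measurable_realfun.measurable_EFinP mh hb.
have [pf pb] := integral_dist_cst_le (jordan_pos (hahnP nu)) mA mh hb.
have [nf nb] := integral_dist_cst_le (jordan_neg (hahnP nu)) mA mh hb.
rewrite /charge_integral.
rewrite (jordan_decomp (hahnP nu) mA) /cadd/= cscaleN1 /charge_variation /=.
move: (integral (jordan_pos _) _ _) (integral (jordan_neg _) _ _) pf pb nf nb.
move=> p n pf pb nf nb.
rewrite fineB// fineB ?fin_num_measure// fineD ?fin_num_measure//.
move: pb nb; rewrite !ler_norml => /andP[? ?] /andP[? ?].
by apply/andP; split; lra.
Qed.

End ChargeIntegralBounds.

(** * Mass of intervals shrinking to a point *)

Section FiniteMeasuresOfShrinkingIntervals.
Context {R : realType}.

Lemma measure_shrinking (mu : {measure set R -> \bar R}) (F : (set R)^nat) :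
  (forall n, measurable (F n)) -> mu (F 0%N) \is a fin_num ->
  nonincreasing_seq F -> \bigcap_n F n = set0 ->
  forall e, 0 < e -> exists n, fine (mu (F n)) <= e.
Proof.
move=> mF F0 niF capF e e0.
have muF n : mu (F n) \is a fin_num.
  rewrite ge0_fin_numE// (@le_lt_trans _ _ (mu (F 0%N)))//.
    by apply: le_measure; rewrite ?inE//; exact/subsetPset/niF.
  by rewrite ltey_eq F0.
have : mu \o F @ \oo --> mu (\bigcap_n F n).
  by apply: nonincreasing_cvg_mu; rewrite ?capF// ltey_eq F0.
rewrite capF measure0 => /fine_cvgP[_].
move=> /cvgrPdist_le/(_ _ e0)[N _ /(_ N (leqnn _))]; rewrite /= sub0r normrN.
by move=> /(le_trans (ler_norm _)) ?; exists N.
Qed.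

Lemma measure_itvoc_right (mu : {measure set R -> \bar R}) :
  (forall A, measurable A -> mu A \is a fin_num) ->
  forall x e, 0 < e -> \forall y \near x^'+, fine (mu `]x, y]) <= e.
Proof.
move=> muf x e e0.
pose F n : set R := `]x, x + n.+1%:R^-1].
have [| | | |N FN] := @measure_shrinking mu F _ _ _ _ e e0.
- by move=> n; exact: measurable_itv.
- by apply: muf; exact: measurable_itv.
- move=> m n mn; apply/subsetPset => y; rewrite /F /= !in_itv /=.
  move=> /andP[-> /le_trans]; apply; rewrite lerD2l lef_pV2 ?posrE//.
  by rewrite ler_nat.
- rewrite -subset0 => y Fy.
  have xy : x < y by have := Fy 0%N I; rewrite /F /= in_itv /= => /andP[].
  have /ltr_add_invr[k] := xy.
  have := Fy k I; rewrite /F /= in_itv /= => /andP[_ yk].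
  by rewrite ltNge yk.
near=> y.
apply: le_trans FN; apply: fine_le; try by apply: muf; exact: measurable_itv.
apply: le_measure; rewrite ?inE; try exact: measurable_itv.
move=> z; rewrite /F /= !in_itv /= => /andP[-> /le_trans]; apply.
by near: y; apply: nbhs_right_le; rewrite ltrDl.
Unshelve. all: by end_near. Qed.

Lemma measure_itvco_left (mu : {measure set R -> \bar R}) :
  (forall A, measurable A -> mu A \is a fin_num) ->
  forall x e, 0 < e -> \forall y \near x^'-, fine (mu `[y, x[) <= e.
Proof.
move=> muf x e e0.
pose F n : set R := `[x - n.+1%:R^-1, x[.
have [| | | |N FN] := @measure_shrinking mu F _ _ _ _ e e0.
- by move=> n; exact: measurable_itv.
- by apply: muf; exact: measurable_itv.
- move=> m n mn; apply/subsetPset => y; rewrite /F /= !in_itv /=.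
  move=> /andP[+ ->]; rewrite andbT; apply: le_trans.
  by rewrite lerD2l lerN2 lef_pV2 ?posrE// ler_nat.
- rewrite -subset0 => y Fy.
  have yx : y < x by have := Fy 0%N I; rewrite /F /= in_itv /= => /andP[].
  have /ltr_add_invr[k] := yx; rewrite -ltrBrDr.
  have := Fy k I; rewrite /F /= in_itv /= => /andP[yk _].
  by rewrite ltNge yk.
near=> y.
apply: le_trans FN; apply: fine_le; try by apply: muf; exact: measurable_itv.
apply: le_measure; rewrite ?inE; try exact: measurable_itv.
move=> z; rewrite /F /= !in_itv /= => /andP[+ ->]; rewrite andbT; apply: le_trans.
by near: y; apply: nbhs_left_ge; rewrite ltrBlDr ltrDl.
Unshelve. all: by end_near. Qed.

Lemma fin_charge_variation (nu : {charge set R -> \bar R}) (A : set R) :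
  measurable A -> charge_variation (hahnP nu) A \is a fin_num.
Proof. by move=> mA; rewrite /charge_variation fin_numD !fin_num_measure. Qed.

Lemma normr_charge_le (nu : {charge set R -> \bar R}) (A : set R) :
  measurable A -> `|fine (nu A)| <= fine (charge_variation (hahnP nu) A).
Proof.
move=> mA; rewrite -lee_fin fineK ?fin_charge_variation//.
have := abse_charge_variation (hahnP nu) mA.
by have /fineK <- := fin_num_measure nu A mA.
Qed.

End FiniteMeasuresOfShrinkingIntervals.

(** * Charges that are nonnegative on half-open intervals *)

Section ChargeNonnegativeOnIntervals.
Context {R : realType} (nu : {charge set R -> \bar R}).
Hypothesis nu_ge0 : forall x y : R, x <= y -> (0 <= nu `]x, y])%E.

Let H (x : R) : R := fine (nu `]-oo, x]).

Let nu_oc (x y : R) : x <= y -> nu `]x, y] = (H y - H x)%:E.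
Proof.
move=> xy; have nf A : measurable A -> nu A \is a fin_num.
  by move=> mA; exact: fin_num_measure.
have E : `]-oo, y]%classic = `]-oo, x] `|` `]x, y] :> set R.
  by rewrite -itv_bndbnd_setU// bnd_simp.
have -> : H y = H x + fine (nu `]x, y]).
  rewrite /H -fineD ?nf//; try exact: measurable_itv.
  rewrite E; congr fine; apply: chargeU; try exact: measurable_itv.
  rewrite -subset0 => z; rewrite /= !in_itv /= => -[zx /andP[xz _]].
  by rewrite ltNge zx in xz.
by rewrite addrAC subrr add0r fineK// nf//; exact: measurable_itv.
Qed.

Let ndH : nondecreasing H.
Proof. by move=> x y xy; have := nu_ge0 xy; rewrite nu_oc// lee_fin subr_ge0. Qed.

Let rcH : right_continuous H.
Proof.
move=> x; apply/cvgrPdist_le => e e0; near=> y.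
have xy : x <= y by near: y; exact: nbhs_right_ge.
have -> : H x - H y = - fine (nu `]x, y]) by rewrite nu_oc//= opprB.
have mI : measurable (`]x, y]%classic : set R) by exact: measurable_itv.
rewrite normrN; apply: (le_trans (normr_charge_le nu mI)).
near: y.
exact: (measure_itvoc_right (@fin_charge_variation _ nu)).
Unshelve. all: by end_near. Qed.

Let G : cumulative R R :=
  HB.pack H (isCumulative.Build R _ R H ndH rcH).

(** The Stieltjes measure [S] of the distribution function [H] agrees with [nu = P - N] on half-open
    intervals. Uniqueness of measures is applied to [S + N] and [P], since [nu] itself is not yet
    known to be a measure; hence [nu] equals [S] on Borel sets. *)
Lemma charge_ge0_of_itv (A : set R) : measurable A -> (0 <= nu A)%E.
Proof.
move=> mA.
pose S : {measure set (measurableTypeR R) -> \bar R} :=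
  lebesgue_stieltjes_measure G.
(* The Jordan parts of [nu], repacked with the display carried by [S]. *)
pose P : {measure set (measurableTypeR R) -> \bar R} :=
  HB.pack (jordan_pos (hahnP nu) : set (measurableTypeR R) -> \bar R)
   (isMeasure.Build _ (measurableTypeR R) R (jordan_pos (hahnP nu))
     (measure0 (jordan_pos (hahnP nu)))
     (measure_ge0 (jordan_pos (hahnP nu)))
     (@measure_semi_sigma_additive _ _ _ (jordan_pos (hahnP nu)))).
pose N : {measure set (measurableTypeR R) -> \bar R} :=
  HB.pack (jordan_neg (hahnP nu) : set (measurableTypeR R) -> \bar R)
   (isMeasure.Build _ (measurableTypeR R) R (jordan_neg (hahnP nu))
     (measure0 (jordan_neg (hahnP nu)))
     (measure_ge0 (jordan_neg (hahnP nu)))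
     (@measure_semi_sigma_additive _ _ _ (jordan_neg (hahnP nu)))).
have nuE B : measurable B -> nu B = (P B - N B)%E.
  by move=> mB; rewrite (jordan_decomp (hahnP nu) mB) /cadd /= cscaleN1.
have Pf B : measurable B -> P B \is a fin_num.
  by move=> mB; apply: (fin_num_measure (jordan_pos (hahnP nu))).
have Nf B : measurable B -> N B \is a fin_num.
  by move=> mB; apply: (fin_num_measure (jordan_neg (hahnP nu))).
have SE x y : x <= y -> S `]x, y] = nu `]x, y].
  move=> xy; rewrite nu_oc//.
  have -> : S `]x, y] = wlength G `]x, y].
    by apply: measurable_mu_extE; exact: is_ocitv.
  by rewrite wlength_itv_bnd.
have key : measure_add S N A = P A.
  apply: (@measure_unique _ R (measurableTypeR R) (@ocitv R)
    (fun n => `](- n%:R), n%:R]%classic)) => //.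
  - exact: ocitvI.
  - by move=> n; exact: is_ocitv.
  - exact: (bigcup_itvT false false).
  - move=> _ [[x y] _ <-]; rewrite [LHS]measure_addE /=.
    have [xy|yx] := leP x y; last first.
      by rewrite set_itv_ge ?bnd_simp -?leNgt ?ltW// !measure0 adde0.
    rewrite SE// nuE ?subeK//; first exact: Nf.
  - move=> n; rewrite [ltLHS]measure_addE SE ?ge0_cp//.
    by rewrite lte_add_pinfty// ltey_eq ?Nf// fin_num_measure.
rewrite nuE// -key measure_addE addeK ?Nf//.
Qed.

End ChargeNonnegativeOnIntervals.

(** * Induction on intervals *)

Section IntervalInduction.
Context {R : realType}.

(** Consider the supremum of the [y] with [P s y]: the left germ at the supremum shows that it is
    attained, and the right germ would push past it if it were below [t]. When [P x y] concerns an
    open interval, the gluing hypothesis is the place where the jump at [z] must be handled. *)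
Lemma interval_induction (P : R -> R -> Prop) (s t : R) : s < t ->
  (forall x z y, s <= x -> x < z -> z < y -> y <= t -> P x z -> P z y -> P x y) ->
  (forall p, s <= p < t -> \forall y \near p^'+, P p y) ->
  (forall p, s < p <= t -> \forall x \near p^'-, P x p) -> P s t.
Proof.
move=> st Ptr Pr Pl.
pose S := [set y | s < y <= t /\ P s y].
have [y0 Sy0] : S !=set0.
  near s^'+ => y; exists y; split.
    by apply/andP; split; near: y; [exact: nbhs_right_gt|exact: nbhs_right_le].
  by near: y; apply: Pr; rewrite lexx.
have hS : has_sup S by split; [exists y0|exists t => y [/andP[]]].
have sq : s < sup S.
  by apply: lt_le_trans (ub_le_sup hS.2 Sy0); case: Sy0 => /andP[].
have qt : sup S <= t by apply: (ge_sup hS.1) => y [/andP[]].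
have Pq : P s (sup S).
  have [x] : exists2 x, s < x < sup S & forall y, x < y < sup S -> P y (sup S).
    have qr : s < sup S <= t by rewrite sq qt.
    have [e /= e0 he] := Pl _ qr.
    (* [e] is the radius on which the left germ holds; the midpoint keeps the witness above [s]. *)
    exists (Num.max ((s + sup S) / 2) (sup S - e / 2)).
      by rewrite lt_max gt_max !midf_lt//= ltrBlDr ltrDl divr_gt0.
    move=> y; rewrite gt_max => /andP[/andP[_ y1] y2]; apply: he => //=.
    rewrite ger0_norm ?subr_ge0 ?ltW//; lra.
  move=> /andP[sx xq] hx.
  have [y [/andP[sy yt] Psy] xy] := sup_gt hS.1 xq.
  have := ub_le_sup hS.2 (conj (introT andP (conj sy yt)) Psy : S y).
  rewrite le_eqVlt => /predU1P[<-//|yq].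
  by apply: (Ptr _ y) => //; apply: hx; rewrite xy.
move: qt; rewrite le_eqVlt => /predU1P[<-//|qt].
exfalso; near (sup S)^'+ => y.
have qy : sup S < y by near: y; exact: nbhs_right_gt.
have yt : y <= t by near: y; exact: nbhs_right_le.
have Sy : S y.
  split; first by rewrite (lt_trans sq).
  apply: (Ptr _ (sup S)) => //.
  by near: y; apply: Pr; rewrite qt ltW.
by have := ub_le_sup hS.2 Sy; rewrite leNgt qy.
Unshelve. all: by end_near. Qed.

End IntervalInduction.

(* [fl f], [fv f], [fr f] stand for [f^-], [f], [f^+]. *)
Record sided (R : realType) := Sided { fl : R -> R; fv : R -> R; fr : R -> R }.

(** * One-sided calculus: gauges, densities, reflections *)

Section Sided.
Context {R : realType}.
Implicit Types (f h a b u g v w : sided R) (m : R -> R -> R) (c d : R).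

(** A [sided] triple does not tie its components together, so [fl f] and [fr f] are required to have
    the same one-sided limits as [fv f]. *)
Definition regulated c d f := forall x, c < x < d -> forall e, 0 < e ->
  (\forall t \near x^'+, [/\ `|fl f t - fr f x| <= e,
      `|fv f t - fr f x| <= e & `|fr f t - fr f x| <= e]) /\
  (\forall t \near x^'-, [/\ `|fl f t - fl f x| <= e,
      `|fv f t - fl f x| <= e & `|fr f t - fl f x| <= e]).

Definition midvalued c d f := forall x, c < x < d ->
  fv f x = 2^-1 * (fl f x + fr f x).

Definition jmp f x := fr f x - fl f x.
Definition inc f x y := fl f y - fr f x.

(* [inc b x y] is the mass given by [db] to the open interval ]x, y[, and a gauge
   [m x y] bounds the mass given to it by [|db|]. *)
Definition gauge c d b m :=
  [/\ forall x y, c < x -> x < y -> y < d -> `|inc b x y| <= m x y,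
      forall x z y, c < x -> x < z -> z < y -> y < d -> m x z + m z y <= m x y,
      forall x e, c < x < d -> 0 < e -> \forall y \near x^'+, m x y <= e
    & forall x e, c < x < d -> 0 < e -> \forall y \near x^'-, m y x <= e].

(* [df = h db], through its consequences on points and on open intervals. *)
Definition density c d f h b m :=
  (forall x, c < x < d -> jmp f x = fv h x * jmp b x) /\
  (forall x y k e, c < x -> x < y -> y < d ->
     (forall z, x < z < y -> `|fv h z - k| <= e) ->
     `|inc f x y - k * inc b x y| <= e * m x y).

Definition increasing c d a := [/\ regulated c d a,
  forall x, c < x < d -> 0 <= jmp a x
  & forall x y, c < x -> x < y -> y < d -> 0 < inc a x y].

(* The system [du = g da], [dg = u db]. *)
Record solves c d a b m u g : Prop := Solves {
  solves_reg : regulated c d u;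
  solves_reg' : regulated c d g;
  solves_mid : midvalued c d u;
  solves_mid' : midvalued c d g;
  solves_gauge : gauge c d b m;
  solves_density : density c d u g a (inc a);
  solves_density' : density c d g u b m }.

Definition omg a b x := 1 - 4^-1 * jmp a x * jmp b x.

Definition flip f := Sided (fr f \o -%R) (fv f \o -%R) (fl f \o -%R).
Definition negs f := Sided (\- fl f) (\- fv f) (\- fr f).

Lemma increasing_gauge c d a : increasing c d a -> gauge c d a (inc a).
Proof.
move=> [ra ja ia]; split.
- by move=> x y cx xy yd; rewrite gtr0_norm// ia.
- move=> x z y cx xz zy yd.
  have := ja z; rewrite (lt_trans cx xz) (lt_trans zy yd) /jmp /inc => /(_ isT).
  lra.
- move=> x e xcd e0; have [+ _] := ra _ xcd _ e0; apply: filterS => y [].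
  by rewrite /inc => /(le_trans (ler_norm _)).
- move=> x e xcd e0; have [_ +] := ra _ xcd _ e0; apply: filterS => y [_ _].
  by rewrite /inc distrC => /(le_trans (ler_norm _)).
Qed.

Lemma near_flip_right (P : R -> Prop) (x : R) :
  (\forall t \near (- x)^'-, P t) -> \forall t \near x^'+, P (- t).
Proof. by rewrite at_leftN. Qed.

Lemma near_flip_left (P : R -> Prop) (x : R) :
  (\forall t \near (- x)^'+, P t) -> \forall t \near x^'-, P (- t).
Proof. by rewrite at_rightN. Qed.

Lemma flip_itv c d x : - d < x < - c -> c < - x < d.
Proof. by move=> /andP[? ?]; apply/andP; split; lra. Qed.

Lemma regulated_flip c d f : regulated c d f -> regulated (- d) (- c) (flip f).
Proof.
move=> rf x /flip_itv xcd e e0; have [hr hl] := rf _ xcd _ e0; split=> /=.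
- by apply: filterS (near_flip_right hl) => t [].
- by apply: filterS (near_flip_left hr) => t [].
Qed.

Lemma regulated_negs c d f : regulated c d f -> regulated c d (negs f).
Proof.
move=> rf x xcd e e0; have [hr hl] := rf _ xcd _ e0.
by split; [apply: filterS hr|apply: filterS hl] => t [] /=;
  rewrite -!opprD !normrN.
Qed.

Lemma solves_negs c d a b m u g :
  solves c d a b m u g -> solves c d a b m (negs u) (negs g).
Proof.
move=> [ru rg mu mg gb [ju iu] [jg ig]]; split => //.
- exact: regulated_negs.
- exact: regulated_negs.
- by move=> x xcd /=; rewrite mu//; lra.
- by move=> x xcd /=; rewrite mg//; lra.
- split.
    by move=> x xcd; have := ju _ xcd; rewrite /jmp /=; lra.
  move=> x y k e cx xy yd hz.
  have /(iu x y (- k) e cx xy yd) : forall z, x < z < y -> `|fv g z - - k| <= e.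
    by move=> z /hz /=; rewrite -opprD normrN opprK.
  rewrite -normrN; congr (`|_| <= _); rewrite /inc /=; ring.
- split.
    by move=> x xcd; have := jg _ xcd; rewrite /jmp /=; lra.
  move=> x y k e cx xy yd hz.
  have /(ig x y (- k) e cx xy yd) : forall z, x < z < y -> `|fv u z - - k| <= e.
    by move=> z /hz /=; rewrite -opprD normrN opprK.
  rewrite -normrN; congr (`|_| <= _); rewrite /inc /=; ring.
Qed.

Definition mirror a := negs (flip a).

Lemma increasing_mirror c d a :
  increasing c d a -> increasing (- d) (- c) (mirror a).
Proof.
move=> [ra ja ia]; split; first exact/regulated_negs/regulated_flip.
- by move=> x /flip_itv/ja; rewrite /jmp /=; lra.
- move=> x y dx xy yc; have := ia (- y) (- x); rewrite /inc /=.
  rewrite ltrNr ltrN2 ltrNl => /(_ yc xy dx); lra.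
Qed.

Lemma omg_mirror a b x : omg (mirror a) (mirror b) x = omg a b (- x).
Proof. by rewrite /omg /jmp /=; ring. Qed.

(* The odd reflections of [a], [b], [g] and the even reflection of [u] solve the
   same system, which turns left endpoints into right ones. *)
Lemma solves_flip c d a b m u g : solves c d a b m u g ->
  solves (- d) (- c) (mirror a) (mirror b) (fun x y => m (- y) (- x))
    (flip u) (mirror g).
Proof.
move=> [ru rg mu mg [g1 g2 g3 g4] [ju iu] [jg ig]]; split => //.
- exact: regulated_flip.
- exact/regulated_negs/regulated_flip.
- by move=> x /flip_itv/mu /= ->; lra.
- by move=> x /flip_itv/mg /= ->; lra.
- split.
  + move=> x y dx xy yc; have := g1 (- y) (- x); rewrite /inc /=.
    rewrite ltrNr ltrN2 ltrNl => /(_ yc xy dx); congr (_ <= _).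
    by congr `|_|; lra.
  + move=> x z y dx xz zy yc; rewrite addrC; apply: g2; lra.
  + by move=> x e /flip_itv xcd e0; exact: near_flip_right (g4 _ _ xcd e0).
  + by move=> x e /flip_itv xcd e0; exact: near_flip_left (g3 _ _ xcd e0).
- split; first by move=> x /flip_itv/ju; rewrite /jmp /=; lra.
  move=> x y k e dx xy yc hz; rewrite /inc /=.
  have /(iu (- y) (- x) (- k) e) : forall z, - y < z < - x -> `|fv g z - - k| <= e.
    move=> z /andP[yz zx]; have := hz (- z); rewrite /= opprK -opprD normrN opprK.
    by apply; apply/andP; split; lra.
  rewrite ltrNr ltrN2 ltrNl => /(_ yc xy dx); rewrite /inc.
  rewrite -normrN => H; apply: le_trans (le_trans _ H) _.
    by rewrite le_eqVlt; apply/orP; left; apply/eqP; congr `|_|; ring.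
  by rewrite le_eqVlt; apply/orP; left; apply/eqP; ring.
- split; first by move=> x /flip_itv/jg; rewrite /jmp /=; lra.
  move=> x y k e dx xy yc hz; rewrite /inc /=.
  have /(ig (- y) (- x) k e) : forall z, - y < z < - x -> `|fv u z - k| <= e.
    move=> z /andP[yz zx]; have := hz (- z); rewrite /= opprK.
    by apply; apply/andP; split; lra.
  rewrite ltrNr ltrN2 ltrNl => /(_ yc xy dx); rewrite /inc.
  by congr (`|_| <= _); ring.
Qed.

End Sided.

(** * Germs on one side of a point *)

Section OneSidedGerms.
Context {R : realType}.
Implicit Types (f h a b u g v w : sided R) (m : R -> R -> R) (c d : R).

Lemma near_right_itv (P : R -> Prop) (x : R) : (\forall t \near x^'+, P t) ->
  \forall y \near x^'+, forall t, x < t < y -> P t.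
Proof.
move=> [e /= e0 he]; near=> y => t /andP[xt ty].
apply: he => //=; rewrite ltr0_norm ?subr_lt0// opprB ltrBlDr addrC.
by apply: lt_trans ty _; near: y; apply: nbhs_right_lt; rewrite ltrDl.
Unshelve. all: by end_near. Qed.

Lemma near_left_itv (P : R -> Prop) (x : R) : (\forall t \near x^'-, P t) ->
  \forall y \near x^'-, forall t, y < t < x -> P t.
Proof.
move=> [e /= e0 he]; near=> y => t /andP[yt tx].
apply: he => //=; rewrite gtr0_norm ?subr_gt0// ltrBlDr addrC -ltrBlDr.
by apply: le_lt_trans yt; near: y; apply: nbhs_left_ge; rewrite ltrBlDr ltrDl.
Unshelve. all: by end_near. Qed.

Lemma near_right_of_itv (P : R -> Prop) (x y : R) : x < y ->
  (forall t, x < t < y -> P t) -> \forall t \near x^'+, P t.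
Proof.
move=> xy h; near=> t; apply: h; apply/andP; split; near: t.
- exact: nbhs_right_gt.
- exact: nbhs_right_lt.
Unshelve. all: by end_near. Qed.

Lemma near_left_of_itv (P : R -> Prop) (x y : R) : x < y ->
  (forall t, x < t < y -> P t) -> \forall t \near y^'-, P t.
Proof.
move=> xy h; near=> t; apply: h; apply/andP; split; near: t.
- exact: nbhs_left_gt.
- exact: nbhs_left_lt.
Unshelve. all: by end_near. Qed.

Lemma regulated_fr_le c d f x k : regulated c d f -> c < x < d ->
  (\forall t \near x^'+, fl f t <= k) -> fr f x <= k.
Proof.
move=> rf xcd fk; apply/ler_addgt0Pr => e e0.
have [fe _] := rf _ xcd _ e0.
near x^'+ => t.
have [ft _ _] : [/\ `|fl f t - fr f x| <= e,
   `|fv f t - fr f x| <= e & `|fr f t - fr f x| <= e] by near: t.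
have tk : fl f t <= k by near: t.
by move: ft; rewrite ler_norml => /andP[? ?]; lra.
Unshelve. all: by end_near. Qed.

Lemma regulated_norm_fr_le c d f x k : regulated c d f -> c < x < d ->
  (\forall t \near x^'+, `|fl f t| <= k) -> `|fr f x| <= k.
Proof.
move=> rf xcd fk; rewrite ler_norml; apply/andP; split.
- rewrite lerNl; apply: (regulated_fr_le (regulated_negs rf) xcd).
  by apply: filterS fk => t; rewrite ler_norml => /andP[? _] /=; lra.
- apply: (regulated_fr_le rf xcd).
  by apply: filterS fk => t; rewrite ler_norml => /andP[_ ?].
Qed.

(** The sign just beside [x], not at [x]: it can be positive even if [fr f x = 0]. *)
Definition pos_right f x := \forall t \near x^'+, 0 < fl f t /\ 0 < fr f t.
Definition pos_left f x := \forall t \near x^'-, 0 < fl f t /\ 0 < fr f t.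

Lemma pos_left_flip f x : pos_left f x -> pos_right (flip f) (- x).
Proof.
rewrite /pos_left -{1}(opprK x) => /near_flip_right.
by apply: filterS => t [].
Qed.

Lemma pos_right_flip f x : pos_right (flip f) (- x) -> pos_left f x.
Proof.
by move=> /near_flip_left; apply: filterS => t []; rewrite /= !opprK.
Qed.

Lemma pos_right_negsF f x : pos_right f x -> pos_right (negs f) x -> False.
Proof.
move=> f1 f2; near x^'+ => t.
have [p _] : 0 < fl f t /\ 0 < fr f t by near: t.
have [q _] : 0 < fl (negs f) t /\ 0 < fr (negs f) t by near: t.
by move: q => /=; lra.
Unshelve. all: by end_near. Qed.

Lemma pos_right_ge0 c d f x :
  regulated c d f -> c < x < d -> pos_right f x -> 0 <= fr f x.
Proof.
move=> rf xcd fx; rewrite -oppr_le0.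
apply: (regulated_fr_le (regulated_negs rf) xcd).
by apply: filterS fx => t [? _] /=; lra.
Qed.

Lemma pos_left_ge0 c d f x :
  regulated c d f -> c < x < d -> pos_left f x -> 0 <= fl f x.
Proof.
move=> rf xcd /pos_left_flip fx.
have := pos_right_ge0 (regulated_flip rf) _ fx; rewrite /= opprK; apply.
by case/andP: xcd => ? ?; apply/andP; split; lra.
Qed.

End OneSidedGerms.

(** * Uniqueness for the linear system *)

Section LinearSystem.
Context {R : realType}.
Implicit Types (f h a b u g v w : sided R) (m : R -> R -> R) (c d : R).

Lemma solves_sides c d a b m u g x : solves c d a b m u g -> c < x < d ->
  [/\ fl u x = fv u x - 2^-1 * fv g x * jmp a x,
      fr u x = fv u x + 2^-1 * fv g x * jmp a x,
      fl g x = fv g x - 2^-1 * fv u x * jmp b x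
    & fr g x = fv g x + 2^-1 * fv u x * jmp b x].
Proof.
move=> [_ _ mu mg _ [ju _] [jg _]] xcd.
have := mu _ xcd; have := mg _ xcd; have := ju _ xcd; have := jg _ xcd.
by rewrite /jmp => ? ? ? ?; split; lra.
Qed.

Definition vanishes u g x := fv u x = 0 /\ fv g x = 0.

Lemma vanishes_right c d a b m u g x : solves c d a b m u g -> c < x < d ->
  vanishes u g x -> fr u x = 0 /\ fr g x = 0.
Proof. by move=> uS xcd [u0 g0]; case: (solves_sides uS xcd); rewrite u0 g0; lra. Qed.

(** The map from the values of [(u, g)] at [x] to their right limits is linear with rows (1, A/2)
    and (B/2, 1), where A and B are the jumps of [a] and [b]. Its determinant is [omg a b x], so it
    is injective. *)
Lemma right_vanishes c d a b m u g x : solves c d a b m u g -> c < x < d ->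
  omg a b x != 0 -> fr u x = 0 -> fr g x = 0 -> vanishes u g x.
Proof.
move=> uS xcd w0 u0 g0; have [_ + _] := solves_sides uS xcd.
rewrite u0 g0 => e1 e2.
have /eqP : fv u x * omg a b x = 0.
  have e3 : fv g x * jmp a x = - (2^-1 * fv u x * jmp b x) * jmp a x.
    by congr (_ * _); lra.
  by rewrite /omg; lra.
rewrite mulf_eq0 (negbTE w0) orbF => /eqP u00; split => //.
by move: e2; rewrite u00; lra.
Qed.

Lemma left_vanishes c d a b m u g x : solves c d a b m u g -> c < x < d ->
  omg a b x != 0 -> fl u x = 0 -> fl g x = 0 -> vanishes u g x.
Proof.
move=> /solves_flip uS /andP[cx xd] w0 u0 g0.
have [] := right_vanishes uS (x := - x).
- by apply/andP; split; lra.
- by rewrite omg_mirror opprK.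
- by rewrite /= opprK.
- by rewrite /= opprK g0 oppr0.
- by rewrite /= opprK => ? /eqP; rewrite oppr_eq0 => /eqP.
Qed.

(* Gronwall: a bound [K] of [u] and [g] on an interval where both driving
   measures have mass at most 1/2 improves to [K / 2]. *)
Lemma vanishing_spreads c d a b m u g x y : increasing c d a ->
  solves c d a b m u g -> c < x -> x < y -> y < d ->
  fr u x = 0 -> fr g x = 0 -> inc a x y <= 2^-1 -> m x y <= 2^-1 ->
  (exists M, forall z, x < z < y -> `|fv u z| <= M /\ `|fv g z| <= M) ->
  fl u y = 0 /\ fl g y = 0.
Proof.
move=> ainc [ru rg mu mg gb [_ du] [_ dg]] cx xy yd u0 g0 ay my [M hM].
(* Used twice: for [u] with density [g] against [a], and for [g] with density [u] against [b]. *)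
have half f h b' m' K : regulated c d f -> midvalued c d f -> fr f x = 0 ->
    gauge c d b' m' -> m' x y <= 2^-1 ->
    (forall z k e, x < z -> z < d -> (forall s, x < s < z -> `|fv h s - k| <= e) ->
       `|inc f x z - k * inc b' x z| <= e * m' x z) ->
    (forall z, x < z < y -> `|fv h z| <= K) ->
    `|fl f y| <= K / 2 /\ forall z, x < z < y -> `|fv f z| <= K / 2.
  move=> rf mf f0 [gn ga _ _] m2 df hK.
  have K0 : 0 <= K.
    by apply: le_trans (hK ((x + y) / 2) _); rewrite ?midf_lt.
  have mxz z : x < z -> z <= y -> m' x z <= 2^-1.
    move=> xz; rewrite le_eqVlt => /predU1P[->//|zy].
    apply: le_trans m2; apply: le_trans (ga _ _ _ cx xz zy yd).
    by rewrite lerDl; apply: le_trans (gn _ _ (lt_trans cx xz) zy yd).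
  have fK z : x < z -> z <= y -> `|fl f z| <= K / 2.
    move=> xz zy.
    (* Comparing the density with the constant 0, at error [K], bounds the increment from [x] by [K]
       times a mass at most 1/2. *)
    have /(df z 0 K xz (le_lt_trans zy yd)) : forall s, x < s < z -> `|fv h s - 0| <= K.
      move=> s /andP[xs sz]; rewrite subr0 hK// xs.
      exact: lt_le_trans zy.
    rewrite mul0r subr0 /inc f0 subr0 => /le_trans; apply.
    by rewrite ler_wpM2l// mxz.
  split; first exact: fK.
  move=> z /andP[xz zy]; have zcd : c < z < d.
    by rewrite (lt_trans cx xz) (lt_trans zy yd).
  have l1 : `|fl f z| <= K / 2 by rewrite fK// ltW.
  have r1 : `|fr f z| <= K / 2.
    apply: (regulated_norm_fr_le rf zcd); apply: (near_right_of_itv zy) => s.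
    by move=> /andP[zs sy]; rewrite fK ?(lt_trans xz)// ltW.
  rewrite mf//; move: l1 r1; rewrite !ler_norml => /andP[? ?] /andP[? ?].
  by apply/andP; split; lra.
(* The smallest common bound of [|u|] and [|g|] satisfies [sup S <= sup S / 2]; the crude bound [M]
   only ensures that it is finite. *)
pose S := [set r | exists2 z, x < z < y & r = `|fv u z| \/ r = `|fv g z|].
have mid : x < (x + y) / 2 < y by rewrite !midf_lt.
have hS : has_sup S.
  split; first by exists `|fv u ((x + y) / 2)|, ((x + y) / 2) => //; left.
  by exists M => r [z /hM[? ?] [->|->]].
have hK z : x < z < y -> `|fv u z| <= sup S /\ `|fv g z| <= sup S.
  by move=> xzy; split; apply: (ub_le_sup hS.2); exists z => //; [left|right].
have [uy uz] := half u g a (inc a) (sup S) ru mu u0 (increasing_gauge ainc) ay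
  (fun z k e xz zd => du x z k e cx xz zd) (fun z xzy => (hK z xzy).2).
have [gy gz] := half g u b m (sup S) rg mg g0 gb my
  (fun z k e xz zd => dg x z k e cx xz zd) (fun z xzy => (hK z xzy).1).
have S0 : sup S <= 0.
  have : sup S <= sup S / 2.
    by apply: (ge_sup hS.1) => r [z xzy [->|->]]; [exact: uz|exact: gz].
  by lra.
by split; apply/eqP; rewrite -normr_le0; lra.
Qed.

Lemma near_small_right c d a b m u g p : increasing c d a ->
  solves c d a b m u g -> c < p < d ->
  \forall y \near p^'+, [/\ y < d, inc a p y <= 2^-1, m p y <= 2^-1 &
    exists M, forall z, p < z < y -> `|fv u z| <= M /\ `|fv g z| <= M].
Proof.
move=> ainc [ru rg _ _ [_ _ mr _] _ _] pcd.
have [_ _ ar _] := increasing_gauge ainc.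
have [ur _] := ru _ pcd 1 ltr01; have [gr _] := rg _ pcd 1 ltr01.
near=> y; split.
- by near: y; apply: nbhs_right_lt; case/andP: pcd.
- by near: y; apply: ar.
- by near: y; apply: mr.
exists (`|fr u p| + `|fr g p| + 1) => z pzy.
have [_ uz _] : [/\ `|fl u z - fr u p| <= 1, `|fv u z - fr u p| <= 1
   & `|fr u z - fr u p| <= 1].
  by move: z pzy; near: y; exact: near_right_itv ur.
have [_ gz _] : [/\ `|fl g z - fr g p| <= 1, `|fv g z - fr g p| <= 1
   & `|fr g z - fr g p| <= 1].
  by move: z pzy uz; near: y; apply: filterS (near_right_itv gr) => y H z /H.
have := ler_normD (fr u p) (fv u z - fr u p); rewrite addrC subrK.
have := ler_normD (fr g p) (fv g z - fr g p); rewrite addrC subrK.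
have := normr_ge0 (fr g p); have := normr_ge0 (fr u p).
by split; lra.
Unshelve. all: by end_near. Qed.

Lemma near_small_left c d a b m u g p : increasing c d a ->
  solves c d a b m u g -> c < p < d ->
  \forall y \near p^'-, [/\ c < y, inc a y p <= 2^-1, m y p <= 2^-1 &
    exists M, forall z, y < z < p -> `|fv u z| <= M /\ `|fv g z| <= M].
Proof.
move=> /increasing_mirror ainc /solves_flip uS /andP[cp pd].
have pcd : - d < - p < - c by apply/andP; split; lra.
have := near_flip_left (near_small_right ainc uS pcd).
apply: filterS => y; rewrite /inc /= !opprK => -[? ? ? [M hM]]; split; try lra.
exists M => z /andP[yz zp]; have := hM (- z); rewrite /= opprK normrN; apply.
by apply/andP; split; lra.
Qed.

(** Zero values at [x] give zero right limits at [x], hence zero left limits at a nearby [y] by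
    [vanishing_spreads], and then zero values at [y] because [omg a b y] is nonzero. Interval
    induction makes this global. *)
Lemma vanishes_after c d a b m u g p q : increasing c d a ->
  solves c d a b m u g -> (forall x, c < x < d -> omg a b x != 0) ->
  c < p -> p < q -> q < d -> vanishes u g p -> vanishes u g q.
Proof.
move=> ainc uS w0 cp pq qd.
apply: (interval_induction (P := fun x y => vanishes u g x -> vanishes u g y)) => //.
- by move=> x z y _ _ _ _ h1 h2 /h1.
- move=> x /andP[px xq]; have xcd : c < x < d by apply/andP; split; lra.
  near=> y => /(vanishes_right uS xcd)[ux gx].
  have xy : x < y by near: y; exact: nbhs_right_gt.
  have [yd ay my My] : [/\ y < d, inc a x y <= 2^-1, m x y <= 2^-1 &
      exists M, forall z, x < z < y -> `|fv u z| <= M /\ `|fv g z| <= M].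
    by near: y; exact: near_small_right ainc uS xcd.
  have ycd : c < y < d by apply/andP; split; lra.
  have cx : c < x by lra.
  have [uy gy] := vanishing_spreads ainc uS cx xy yd ux gx ay my My.
  exact: (left_vanishes uS ycd (w0 _ ycd)).
- move=> y /andP[py yq]; have ycd : c < y < d by apply/andP; split; lra.
  near=> x.
  have xy : x < y by near: x; exact: nbhs_left_lt.
  have [cx ay my My] : [/\ c < x, inc a x y <= 2^-1, m x y <= 2^-1 &
      exists M, forall z, x < z < y -> `|fv u z| <= M /\ `|fv g z| <= M].
    by near: x; exact: near_small_left ainc uS ycd.
  have xcd : c < x < d by apply/andP; split; lra.
  move=> /(vanishes_right uS xcd)[ux gx].
  have yd : y < d by lra.
  have [uy gy] := vanishing_spreads ainc uS cx xy yd ux gx ay my My.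
  exact: (left_vanishes uS ycd (w0 _ ycd)).
Unshelve. all: by end_near. Qed.

Lemma nowhere_vanishes c d a b m u g q p : increasing c d a ->
  solves c d a b m u g -> (forall x, c < x < d -> omg a b x != 0) ->
  c < q < d -> fv u q != 0 -> c < p < d -> ~ vanishes u g p.
Proof.
move=> ainc uS w0 /andP[cq qd] uq /andP[cp pd] zp.
have [pq|qp|pq] := ltgtP p q.
- have [/eqP] := vanishes_after ainc uS w0 cp pq qd zp.
  by rewrite (negbTE uq).
- have := vanishes_after (increasing_mirror ainc) (solves_flip uS) _
    (p := - p) (q := - q).
  case=> //=.
  + move=> x /flip_itv/w0; rewrite omg_mirror.
    by [].
  + by lra.
  + by lra.
  + by lra.
  + by case: zp => u0 g0; split; rewrite /= opprK ?u0 ?g0 ?oppr0.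
  + by rewrite opprK => /eqP; rewrite (negbTE uq).
- by case: zp; rewrite pq => /eqP; rewrite (negbTE uq).
Qed.

End LinearSystem.

(** * Signs of nonvanishing solutions *)

Section SignsOfSolutions.
Context {R : realType}.
Implicit Types (f h a b u g v w : sided R) (m : R -> R -> R) (c d : R).

Lemma pos_right_of_gt0 c d f x : regulated c d f -> c < x < d ->
  0 < fr f x -> pos_right f x.
Proof.
move=> rf xcd f0; have f02 : 0 < fr f x / 2 by rewrite divr_gt0.
have [+ _] := rf _ xcd _ f02; apply: filterS => t [].
by rewrite !ler_norml => /andP[? ?] _ /andP[? ?]; split; lra.
Qed.

(** Close to [p] the density [g] exceeds half of [fr g p], so [fl u y] is at least [fr g p / 2]
    times the positive mass [inc a p y]; the jump of [u] at [y] is then nonnegative. *)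
Lemma pos_right_of_deriv c d a b m u g p : increasing c d a ->
  solves c d a b m u g -> c < p < d -> fr u p = 0 -> 0 < fr g p -> pos_right u p.
Proof.
move=> [_ ja ia] uS pcd u0 g0; have g02 : 0 < fr g p / 2 by rewrite divr_gt0.
have [gp _] := solves_reg' uS pcd g02; case/andP: (pcd) => cp pd.
near=> y.
have py : p < y by near: y; exact: nbhs_right_gt.
have yd : y < d by near: y; exact: nbhs_right_lt.
have ycd : c < y < d by rewrite (lt_trans cp).
have gy : fr g p / 2 <= fv g y.
  have [_ + _] : [/\ `|fl g y - fr g p| <= fr g p / 2,
    `|fv g y - fr g p| <= fr g p / 2 & `|fr g y - fr g p| <= fr g p / 2].
    by near: y.
  by rewrite ler_norml => /andP[? ?]; lra.
have gz : forall z, p < z < y -> `|fv g z - fr g p| <= fr g p / 2.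
  by near: y; apply: filterS (near_right_itv gp) => y hy z /hy[].
have [_ du] := solves_density uS.
have := du _ _ _ _ cp py yd gz; rewrite {1}/inc u0 subr0.
rewrite ler_norml => /andP[l1 _].
have l0 : 0 < fl u y.
  have : 0 < fr g p / 2 * inc a p y by rewrite mulr_gt0// ia.
  by lra.
split=> //; have := (solves_density uS).1 _ ycd.
have : 0 <= fv g y * jmp a y by rewrite mulr_ge0 ?ja//; lra.
by rewrite {2}/jmp; lra.
Unshelve. all: by end_near. Qed.

(** If [fr u p] is nonzero it fixes the sign. Otherwise [fr g p] is nonzero, since both limits being
    0 would force [vanishes u g p], and its sign decides. *)
Lemma pos_right_or_negs c d a b m u g p : increasing c d a ->
  solves c d a b m u g -> c < p < d -> omg a b p != 0 -> ~ vanishes u g p ->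
  pos_right u p \/ pos_right (negs u) p.
Proof.
move=> ainc uS pcd w0 nz.
have uS' := solves_negs uS.
have [u0|u0|u0] := ltgtP (fr u p) 0.
- right; apply: (pos_right_of_gt0 (solves_reg uS') pcd); rewrite /=; lra.
- by left; apply: (pos_right_of_gt0 (solves_reg uS) pcd).
have [g0|g0|g0] := ltgtP (fr g p) 0.
- by right; apply: (pos_right_of_deriv ainc uS' pcd); rewrite /=; lra.
- by left; apply: (pos_right_of_deriv ainc uS pcd).
- by case: nz; exact: right_vanishes uS pcd w0 u0 g0.
Qed.

Lemma pos_left_or_negs c d a b m u g p : increasing c d a ->
  solves c d a b m u g -> c < p < d -> omg a b p != 0 -> ~ vanishes u g p ->
  pos_left u p \/ pos_left (negs u) p.
Proof.
move=> /increasing_mirror ainc /solves_flip uS /andP[cp pd] w0 nz.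
have [] := pos_right_or_negs ainc uS (p := - p).
- by apply/andP; split; lra.
- by rewrite omg_mirror opprK.
- move=> [/=]; rewrite opprK => u0 /eqP; rewrite oppr_eq0 => /eqP g0.
  by apply: nz.
- by left; exact: pos_right_flip.
- by right; exact: pos_right_flip.
Qed.

Lemma deriv_ge0_of_pos_right c d a b m u g p : increasing c d a ->
  solves c d a b m u g -> c < p < d -> fr u p = 0 -> pos_right u p -> 0 <= fr g p.
Proof.
move=> ainc uS pcd u0 up; rewrite leNgt; apply/negP => g0.
apply: (pos_right_negsF up); apply: (pos_right_of_deriv ainc (solves_negs uS) pcd).
- by rewrite /= u0 oppr0.
- by rewrite /=; lra.
Qed.

Definition switches v x := (pos_left v x /\ pos_right (negs v) x) \/
  (pos_left (negs v) x /\ pos_right v x).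

Lemma negsK f : negs (negs f) = f.
Proof.
by case: f => l v r; rewrite /negs /=; congr Sided; apply/funext => x; rewrite /= opprK.
Qed.

Lemma switches_negs v x : switches (negs v) x -> switches v x.
Proof. by rewrite /switches negsK => -[[? ?]|[? ?]]; [right|left]. Qed.

(** Interval induction on the implication itself. At a gluing point the right germ has a definite
    sign, and a negative one would be a switch. Just left of [p], a negative germ at [p] would
    contradict positivity to the right of every nearby [x]. *)
Lemma pos_left_of_no_switch c d a b m v h s t : increasing c d a ->
  solves c d a b m v h -> (forall x, c < x < d -> omg a b x != 0) ->
  (forall x, c < x < d -> ~ vanishes v h x) -> c < s -> s < t -> t < d ->
  (forall x, s < x < t -> ~ switches v x) -> pos_right v s -> pos_left v t.
Proof.
move=> ainc vS w0 nz cs st td nsw.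
apply: (interval_induction (P := fun x y => pos_right v x -> pos_left v y)) => //.
- move=> x z y sx xz zy yt h1 h2 /h1 zl.
  have zcd : c < z < d by apply/andP; split; lra.
  have [|zr] := pos_right_or_negs ainc vS zcd (w0 _ zcd) (nz _ zcd); first exact: h2.
  case: (nsw z); first by apply/andP; split; lra.
  by left.
- move=> p /andP[sp pt]; near=> y => pr.
  have py : p < y by near: y; exact: nbhs_right_gt.
  apply: (near_left_of_itv py).
  move: pr; near: y.
  have [pr|npr] := pselect (pos_right v p); last by apply: nearW => y /npr.
  by apply: filterS (near_right_itv pr) => y hy _.
- move=> p /andP[sp pt]; have pcd : c < p < d by apply/andP; split; lra.
  have [pl|pl] := pos_left_or_negs ainc vS pcd (w0 _ pcd) (nz _ pcd).
    by apply: nearW => x _.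
  near=> x => xr; exfalso.
  have xp : x < p by near: x; exact: nbhs_left_lt.
  apply: (pos_right_negsF xr); apply: (near_right_of_itv xp).
  by near: x; exact: near_left_itv pl.
Unshelve. all: by end_near. Qed.

Lemma nonneg_of_no_switch c d a b m v h s t : increasing c d a ->
  solves c d a b m v h -> (forall x, c < x < d -> omg a b x != 0) ->
  (forall x, c < x < d -> ~ vanishes v h x) -> c < s -> s < t -> t < d ->
  (forall x, s < x < t -> ~ switches v x) -> pos_right v s ->
  (forall x, s < x -> x <= t -> 0 <= fl v x) /\
  (forall x, s <= x -> x < t -> 0 <= fr v x).
Proof.
move=> ainc vS w0 nz cs st td nsw vs.
have pl x : s < x -> x <= t -> pos_left v x.
  move=> sx xt; apply: (pos_left_of_no_switch ainc vS w0 nz cs sx) => //; first by lra.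
  by move=> y /andP[sy yx]; apply: nsw; apply/andP; split; lra.
split=> x sx xt.
  have xcd : c < x < d by apply/andP; split; lra.
  exact: pos_left_ge0 (solves_reg vS) xcd (pl _ sx xt).
have xcd : c < x < d by apply/andP; split; lra.
apply: (pos_right_ge0 (solves_reg vS) xcd).
move: sx; rewrite le_eqVlt => /predU1P[<-//|sx].
have [//|xr] := pos_right_or_negs ainc vS xcd (w0 _ xcd) (nz _ xcd).
case: (nsw x); first by rewrite sx.
by left; split=> //; exact: pl (ltW xt).
Qed.

End SignsOfSolutions.

(** * Algebra of the Wronskian increment *)

Section Wronskian.
Context {R : realType}.
Implicit Types (f h a b u g v w : sided R) (m : R -> R -> R) (c d : R).

Definition wrl u g v h x := fl u x * fl h x - fl g x * fl v x.
Definition wrr u g v h x := fr u x * fr h x - fr g x * fr v x.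

(** Index 0 stands for right limits at the left end of a short interval, index 1 for left limits at
    its right end; [ku], [kv], [kg], [kh] are reference values within [e]. The two contributions
    [kg * kh * A] cancel, and the surviving main term [ku * kv * (B2 - B1)] has the favourable
    sign. *)
Lemma bilinear_increment_le (u0 v0 g0 h0 u1 v1 g1 h1 ku kv kg kh e A B1 B2 m1 m2 : R) :
  `|u0 - ku| <= e -> `|v0 - kv| <= e -> `|g0 - kg| <= e -> `|h0 - kh| <= e ->
  `|u1 - ku| <= e -> `|v1 - kv| <= e -> `|g1 - kg| <= e -> `|h1 - kh| <= e ->
  e <= 1 -> 0 <= A -> `|B1| <= m1 -> `|B2| <= m2 -> B2 <= B1 -> 0 <= ku * kv ->
  `|u1 - u0 - kg * A| <= e * A -> `|g1 - g0 - ku * B1| <= e * m1 ->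
  `|v1 - v0 - kh * A| <= e * A -> `|h1 - h0 - kv * B2| <= e * m2 ->
  (u1 * h1 - g1 * v1) - (u0 * h0 - g0 * v0) <=
    e * (4 * (1 + `|ku| + `|kv| + `|kg| + `|kh|)) * (A + m1 + m2).
Proof.
set C := 1 + _ + _ + _ + _.
have nu := normr_ge0 ku; have nv := normr_ge0 kv.
have ng := normr_ge0 kg; have nh := normr_ge0 kh.
have kuC : `|ku| <= C - 1 by rewrite /C; lra.
have kvC : `|kv| <= C - 1 by rewrite /C; lra.
have kgC : `|kg| <= C - 1 by rewrite /C; lra.
have khC : `|kh| <= C - 1 by rewrite /C; lra.
have C0 : 0 <= C by rewrite /C; lra.
clearbody C; clear nu nv ng nh.
have leC (x : R) : `|x| <= C - 1 -> `|x| <= C by lra.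
have bnd (x y X Y : R) : `|x| <= X -> `|y| <= Y -> x * y <= X * Y.
  move=> xX yY; apply: le_trans (ler_norm _) _; rewrite normrM.
  exact: ler_pM.
have near_bnd (x k : R) : e <= 1 -> `|k| <= C - 1 -> `|x - k| <= e -> `|x| <= C.
  by move=> e1 xC xk; have := ler_normD (x - k) k; rewrite subrK; lra.
move=> hu0 hv0 hg0 hh0 hu1 hv1 hg1 hh1 e1 A0 hB1 hB2 B21 k0 du dg dv dh.
have e0 : 0 <= e by apply: le_trans hu0.
have m10 : 0 <= m1 by apply: le_trans hB1.
have m20 : 0 <= m2 by apply: le_trans hB2.
have -> : (u1 * h1 - g1 * v1) - (u0 * h0 - g0 * v0) =
  u0 * (h1 - h0 - kv * B2) + (- v0) * (g1 - g0 - ku * B1)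
  + h1 * (u1 - u0 - kg * A) + (- g1) * (v1 - v0 - kh * A)
  + (u0 - ku) * (kv * B2) + (kv - v0) * (ku * B1)
  + ku * kv * (B2 - B1)
  + (h1 - kh) * (kg * A) + (kg - g1) * (kh * A) by ring.
have p1 := bnd u0 _ C _ (near_bnd u0 ku e1 kuC hu0) dh.
have p2 : - v0 * (g1 - g0 - ku * B1) <= C * (e * m1).
  by apply: bnd => //; rewrite normrN; exact: near_bnd e1 kvC hv0.
have p3 := bnd h1 _ C _ (near_bnd h1 kh e1 khC hh1) du.
have p4 : - g1 * (v1 - v0 - kh * A) <= C * (e * A).
  by apply: bnd => //; rewrite normrN; exact: near_bnd e1 kgC hg1.
have q1 : (u0 - ku) * (kv * B2) <= e * (C * m2).
  by apply: bnd => //; rewrite normrM; apply: ler_pM => //; exact: leC.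
have q2 : (kv - v0) * (ku * B1) <= e * (C * m1).
  apply: bnd; first by rewrite distrC.
  by rewrite normrM; apply: ler_pM => //; exact: leC.
have q3 : (h1 - kh) * (kg * A) <= e * (C * A).
  by apply: bnd => //; rewrite normrM (ger0_norm A0) ler_wpM2r// leC.
have q4 : (kg - g1) * (kh * A) <= e * (C * A).
  apply: bnd; first by rewrite distrC.
  by rewrite normrM (ger0_norm A0) ler_wpM2r// leC.
have q5 : ku * kv * (B2 - B1) <= 0 by rewrite mulr_ge0_le0// subr_le0.
(* [A] collects four error terms but [m1] and [m2] only two each; this and the next line pad them to
   the common factor 4. *)
have e3 : 0 <= e * C * m1 by rewrite !mulr_ge0.
have e4 : 0 <= e * C * m2 by rewrite !mulr_ge0.
move: p1 p2 p3 p4 q1 q2 q3 q4 q5 e3 e4; clear; lra.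
Qed.

End Wronskian.

(** * Monotonicity of the Wronskian and the comparison argument *)

Section WronskianMonotone.
Context {R : realType}.
Implicit Types (f h a b u g v w : sided R) (m : R -> R -> R) (c d : R).

Definition close_on f k e x y := [/\ `|fr f x - k| <= e, `|fl f y - k| <= e
  & forall z, x < z < y -> `|fv f z - k| <= e].

Lemma close_on_right c d f p e : regulated c d f -> c < p < d -> 0 < e ->
  \forall y \near p^'+, close_on f (fr f p) e p y.
Proof.
move=> rf pcd e0; have [fe _] := rf _ pcd _ e0; near=> y; split.
- by rewrite subrr normr0 ltW.
- by near: y; apply: filterS fe => y [].
- by near: y; apply: filterS (near_right_itv fe) => y hy z /hy[].
Unshelve. all: by end_near. Qed.

Lemma close_on_left c d f p e : regulated c d f -> c < p < d -> 0 < e ->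
  \forall x \near p^'-, close_on f (fl f p) e x p.
Proof.
move=> rf pcd e0; have [_ fe] := rf _ pcd _ e0; near=> x; split.
- by near: x; apply: filterS fe => x [].
- by rewrite subrr normr0 ltW.
- by near: x; apply: filterS (near_left_itv fe) => x hx z /hx[].
Unshelve. all: by end_near. Qed.

Lemma wronskian_step c d a b1 b2 m1 m2 u g v h ku kg kv kh e x y :
  increasing c d a -> solves c d a b1 m1 u g -> solves c d a b2 m2 v h ->
  c < x -> x < y -> y < d ->
  close_on u ku e x y -> close_on g kg e x y ->
  close_on v kv e x y -> close_on h kh e x y -> e <= 1 ->
  inc b2 x y <= inc b1 x y -> 0 <= ku * kv ->
  wrl u g v h y - wrr u g v h x <=
    e * (4 * (1 + `|ku| + `|kv| + `|kg| + `|kh|)) * (inc a x y + m1 x y + m2 x y).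
Proof.
move=> [_ _ ia] [_ _ _ _ [n1 _ _ _] [_ du] [_ dg]].
move=> [_ _ _ _ [n2 _ _ _] [_ dv] [_ dh]] cx xy yd.
move=> [ux uy uz] [gx gy gz] [vx vy vz] [hx hy hz] e1 b21 k0.
apply: (bilinear_increment_le (B1 := inc b1 x y) (B2 := inc b2 x y)) => //.
- by rewrite ltW// ia.
- exact: n1.
- exact: n2.
- exact: du.
- exact: dg.
- exact: dv.
- exact: dh.
Qed.

Lemma wronskian_jump c d a b1 b2 m1 m2 u g v h x :
  solves c d a b1 m1 u g -> solves c d a b2 m2 v h -> c < x < d ->
  jmp b2 x <= jmp b1 x -> 0 <= fv u x -> 0 <= fv v x ->
  wrr u g v h x <= wrl u g v h x.
Proof.
move=> uS vS xcd b21 u0 v0; rewrite -subr_le0 /wrr /wrl.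
have [-> -> -> ->] := solves_sides uS xcd.
have [-> -> -> ->] := solves_sides vS xcd.
(* The jump of the Wronskian is exactly this product: the values are midpoints, and the terms in
   [jmp a x] cancel. *)
have : fv u x * fv v x * (jmp b2 x - jmp b1 x) <= 0.
  by rewrite mulr_ge0_le0 ?mulr_ge0// subr_le0.
by apply: le_trans; rewrite le_eqVlt; apply/orP; left; apply/eqP; field.
Qed.

(** The local error is [e] times the mass [M], and [M] is superadditive, so gluing never makes the
    total exceed [e * M s t]. Jumps at gluing points only lower the Wronskian. Finally [e] is
    arbitrary. *)
Lemma wronskian_decreases c d a b1 b2 m1 m2 u g v h s t :
  increasing c d a -> solves c d a b1 m1 u g -> solves c d a b2 m2 v h ->
  c < s -> s < t -> t < d ->
  (forall x y, s <= x -> x < y -> y <= t -> inc b2 x y <= inc b1 x y) ->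
  (forall x, s < x < t -> jmp b2 x <= jmp b1 x) ->
  (forall x, s < x -> x <= t -> 0 <= fl u x) ->
  (forall x, s <= x -> x < t -> 0 <= fr u x) ->
  (forall x, s < x -> x <= t -> 0 <= fl v x) ->
  (forall x, s <= x -> x < t -> 0 <= fr v x) ->
  wrl u g v h t <= wrr u g v h s.
Proof.
move=> ainc uS vS cs st td b21 j21 ul ur vl vr.
have [an aa _ _] := increasing_gauge ainc.
have [n1 s1 _ _] := solves_gauge uS; have [n2 s2 _ _] := solves_gauge vS.
pose M x y := inc a x y + m1 x y + m2 x y.
have M0 x y : c < x -> x < y -> y < d -> 0 <= M x y.
  move=> cx xy yd; rewrite /M; have := an _ _ cx xy yd.
  have := n1 _ _ cx xy yd; have := n2 _ _ cx xy yd.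
  have := normr_ge0 (inc a x y); have := normr_ge0 (inc b1 x y).
  by have := normr_ge0 (inc b2 x y); lra.
suff key e : 0 < e -> wrl u g v h t - wrr u g v h s <= e * M s t.
  rewrite leNgt; apply/negP => lt_w.
  have Mst := M0 _ _ cs st td.
  have M1 : 0 < M s t + 1 by lra.
  (* This choice of [e] bounds a positive gap by less than itself; the 1 guards against
     [M s t = 0]. *)
  have /key : 0 < (wrl u g v h t - wrr u g v h s) / (M s t + 1).
    by rewrite divr_gt0// subr_gt0.
  rewrite mulrAC ler_pdivlMr//; nra.
move=> e0; pose P x y := wrl u g v h y - wrr u g v h x <= e * M x y.
apply: (interval_induction (P := P)) => //; rewrite /P.
- move=> x z y sx xz zy yt h1 h2.
  have zcd : c < z < d by apply/andP; split; lra.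
  have z1 : s < z by lra.
  have z2 : z < t by lra.
  have uv w b m w' : solves c d a b m w w' -> 0 <= fl w z -> 0 <= fr w z -> 0 <= fv w z.
    by move=> wS; rewrite (solves_mid wS)//; lra.
  have szt : s < z < t by rewrite z1.
  have jz := wronskian_jump uS vS zcd (j21 z szt)
    (uv _ _ _ _ uS (ul _ z1 (ltW z2)) (ur _ (ltW z1) z2))
    (uv _ _ _ _ vS (vl _ z1 (ltW z2)) (vr _ (ltW z1) z2)).
  have cx : c < x by lra.
  have yd : y < d by lra.
  have : e * (M x z + M z y) <= e * M x y.
    apply: ler_wpM2l; [exact: ltW|rewrite /M].
    have := aa _ _ _ cx xz zy yd; have := s1 _ _ _ cx xz zy yd.
    by have := s2 _ _ _ cx xz zy yd; lra.
  lra.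
- move=> p /andP[sp pt]; have pcd : c < p < d by apply/andP; split; lra.
  pose C := 4 * (1 + `|fr u p| + `|fr v p| + `|fr g p| + `|fr h p|).
  have C0 : 0 < C by rewrite mulr_gt0// -!addrA ltr_pwDl// !addr_ge0.
  (* [C] is the constant of [wronskian_step] at the limits in [p]; [r] must be at most 1 for that
     lemma and satisfy [r * C <= e]. *)
  pose r := Num.min 1 (e / C).
  have r0 : 0 < r by rewrite lt_min ltr01 divr_gt0.
  near=> y.
  have py : p < y by near: y; exact: nbhs_right_gt.
  have yt : y <= t by near: y; exact: nbhs_right_le.
  have cp : c < p by lra.
  have yd : y < d by lra.
  have := wronskian_step ainc uS vS cp py yd (ku := fr u p) (kg := fr g p)
    (kv := fr v p) (kh := fr h p) (e := r).
  move=> /(_ _ _ _ _ _ _ _)/le_trans; apply.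
  + by near: y; exact: close_on_right (solves_reg uS) pcd r0.
  + by near: y; exact: close_on_right (solves_reg' uS) pcd r0.
  + by near: y; exact: close_on_right (solves_reg vS) pcd r0.
  + by near: y; exact: close_on_right (solves_reg' vS) pcd r0.
  + by rewrite /r ge_min lexx.
  + exact: b21.
  + by rewrite mulr_ge0 ?ur ?vr.
  + apply: ler_wpM2r; first exact: M0.
    by rewrite -ler_pdivlMr// /r ge_min lexx orbT.
- move=> p /andP[sp pt]; have pcd : c < p < d by apply/andP; split; lra.
  pose C := 4 * (1 + `|fl u p| + `|fl v p| + `|fl g p| + `|fl h p|).
  have C0 : 0 < C by rewrite mulr_gt0// -!addrA ltr_pwDl// !addr_ge0.
  pose r := Num.min 1 (e / C).
  have r0 : 0 < r by rewrite lt_min ltr01 divr_gt0.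
  near=> x.
  have xp : x < p by near: x; exact: nbhs_left_lt.
  have sx : s <= x by near: x; exact: nbhs_left_ge.
  have pd : p < d by lra.
  have cx : c < x by lra.
  have := wronskian_step ainc uS vS cx xp pd (ku := fl u p) (kg := fl g p)
    (kv := fl v p) (kh := fl h p) (e := r).
  move=> /(_ _ _ _ _ _ _ _)/le_trans; apply.
  + by near: x; exact: close_on_left (solves_reg uS) pcd r0.
  + by near: x; exact: close_on_left (solves_reg' uS) pcd r0.
  + by near: x; exact: close_on_left (solves_reg vS) pcd r0.
  + by near: x; exact: close_on_left (solves_reg' vS) pcd r0.
  + by rewrite /r ge_min lexx.
  + exact: b21.
  + by rewrite mulr_ge0 ?ul ?vl.
  + apply: ler_wpM2r; first exact: M0.
    by rewrite -ler_pdivlMr// /r ge_min lexx orbT.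
Unshelve. all: by end_near. Qed.

(* [U, G, V, H] are the values at a point of [u, g, v, h], and [A, B1, B2] the
   jumps of the coefficients. *)
Lemma endpoint_wronskian (U G V H A B1 B2 : R) : 0 <= A -> B2 <= B1 ->
  0 < 1 - 4^-1 * A * B1 ->
  U - 2^-1 * G * A <= 0 -> 0 < U + 2^-1 * G * A ->
  0 <= V - 2^-1 * H * A -> 0 <= V + 2^-1 * H * A ->
  let W := (U + 2^-1 * G * A) * (H + 2^-1 * V * B2) -
           (G + 2^-1 * U * B1) * (V + 2^-1 * H * A) in
  W <= 0 /\ (U - 2^-1 * G * A < 0 -> V != 0 \/ H != 0 -> W < 0).
Proof.
move=> A0 B21 w0 ul ur vl vr W.
(* For [B1 = B2] both pairs undergo the same linear map, which multiplies the Wronskian by its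
   determinant; the last term is the effect of [B1 - B2]. *)
have WE : W = (1 - 4^-1 * A * B1) * (U * H - G * V) -
  2^-1 * (B1 - B2) * V * (U + 2^-1 * G * A) by rewrite /W; field.
have V0 : 0 <= V by lra.
(* [G * A] is the jump of u, from a value at most 0 to a positive one; in particular [A] cannot be
   0. *)
have GA : 0 < G * A by lra.
have Apos : 0 < A.
  by rewrite lt_def A0 andbT; apply/eqP => A00; move: GA; rewrite A00 mulr0 ltxx.
have rest : 0 <= 2^-1 * (B1 - B2) * V * (U + 2^-1 * G * A).
  by rewrite !mulr_ge0// ?subr_ge0// ltW.
(* Multiplication by [A] turns [G] and [H] into jumps of u and v, so this is u^- v^+ - u^+ v^-,
   whose sign is known. *)
have E : A * (U * H - G * V) =
    (U - 2^-1 * G * A) * (V + 2^-1 * H * A) - (U + 2^-1 * G * A) * (V - 2^-1 * H * A).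
  by field.
have t1 : (U - 2^-1 * G * A) * (V + 2^-1 * H * A) <= 0 by rewrite mulr_le0_ge0.
have t2 : 0 <= (U + 2^-1 * G * A) * (V - 2^-1 * H * A) by rewrite mulr_ge0// ltW.
split.
  have : U * H - G * V <= 0 by rewrite -(pmulr_rle0 _ Apos) E; lra.
  by move=> D0; have := mulr_ge0_le0 (ltW w0) D0; lra.
move=> ul' VH.
have : U * H - G * V < 0.
  rewrite -(pmulr_rlt0 _ Apos) E.
  (* If either limit of v is positive, one of the two products is strict; if both are 0, then [V]
     and [H] vanish. *)
  have [v1|v1] := ltP 0 (V - 2^-1 * H * A).
    by have := mulr_gt0 ur v1; lra.
  have [v2|v2] := ltP 0 (V + 2^-1 * H * A).
    have : (U - 2^-1 * G * A) * (V + 2^-1 * H * A) < 0 by rewrite nmulr_rlt0.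
    by lra.
  have V00 : V = 0 by lra.
  have /eqP : H * A = 0 by lra.
  rewrite mulf_eq0 (gt_eqF Apos) orbF => /eqP H00.
  by case: VH; rewrite ?V00 ?H00 eqxx.
by rewrite -(pmulr_rlt0 _ w0); lra.
Qed.

(** If [fr u s = 0], only the term - g^+ v^+ remains, and positivity of [u] to the right forces g^+
    >= 0; the strict claim is then vacuous. Otherwise [u] passes from nonpositive to positive at [s]
    and [endpoint_wronskian] applies. *)
Lemma wronskian_left_end c d a b1 b2 m1 m2 u g v h s :
  increasing c d a -> solves c d a b1 m1 u g -> solves c d a b2 m2 v h ->
  c < s < d -> ~ vanishes v h s -> pos_right u s -> pos_right v s ->
  fr u s = 0 \/ [/\ fl u s * fr u s <= 0, 0 < omg a b1 s, jmp b2 s <= jmp b1 s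
    & 0 <= fl v s] ->
  wrr u g v h s <= 0 /\ (fl u s * fr u s < 0 -> wrr u g v h s < 0).
Proof.
move=> ainc uS vS scd nz us vs.
have ur := pos_right_ge0 (solves_reg uS) scd us.
have vr := pos_right_ge0 (solves_reg vS) scd vs.
have [u0 _|u0] := eqVneq (fr u s) 0.
  have g0 := deriv_ge0_of_pos_right ainc uS scd u0 us.
  rewrite /wrr u0 mul0r sub0r mulr0 ltxx; split=> //.
  by rewrite oppr_le0 mulr_ge0.
case=> [/eqP|[ulr w0 j21 vl]]; first by rewrite (negbTE u0).
have ur' : 0 < fr u s by rewrite lt_def u0.
have ul : fl u s <= 0 by rewrite -(pmulr_lle0 _ ur').
have [_ ja _] := ainc.
have [ulE urE _ grE] := solves_sides uS scd.
have [vlE vrE _ hrE] := solves_sides vS scd.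
rewrite /wrr grE hrE.
have [|||||||W0 W1] := @endpoint_wronskian (fv u s) (fv g s) (fv v s) (fv h s)
  (jmp a s) (jmp b1 s) (jmp b2 s); rewrite -?ulE -?urE -?vlE -?vrE ?ja//.
move: W0 W1; rewrite -ulE -urE -vrE => W0 W1; split => //.
rewrite (pmulr_llt0 _ ur') => ul'; apply: W1 => //.
have [v0|] := eqVneq (fv v s) 0; last by left.
have [h0|] := eqVneq (fv h s) 0; last by right.
by case: nz.
Qed.

Lemma jmp_mirror a x : jmp (mirror a) x = jmp a (- x).
Proof. by rewrite /jmp /=; ring. Qed.

(** Reflection leaves [u] and [v] even but makes their quasi-derivatives odd, so it reverses the
    sign of the Wronskian. *)
Lemma wronskian_right_end c d a b1 b2 m1 m2 u g v h t :
  increasing c d a -> solves c d a b1 m1 u g -> solves c d a b2 m2 v h ->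
  c < t < d -> ~ vanishes v h t -> pos_left u t -> pos_left v t ->
  fl u t = 0 \/ [/\ fl u t * fr u t <= 0, 0 < omg a b1 t, jmp b2 t <= jmp b1 t
    & 0 <= fr v t] ->
  0 <= wrl u g v h t /\ (fl u t * fr u t < 0 -> 0 < wrl u g v h t).
Proof.
move=> /increasing_mirror ainc /solves_flip uS /solves_flip vS /andP[ct td] nz.
move=> /pos_left_flip ut /pos_left_flip vt ends.
have tcd : - d < - t < - c by apply/andP; split; lra.
have [] := wronskian_left_end ainc uS vS tcd _ ut vt.
- move=> [/=]; rewrite opprK => v0 /eqP; rewrite oppr_eq0 => /eqP h0.
  by apply: nz.
- case: ends => [ut0|[ulr w0 j21 vr]]; [left|right]; first by rewrite /= opprK.
  by rewrite omg_mirror !jmp_mirror /= !opprK mulrC.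
- rewrite /wrr /wrl /= !opprK => W0 W1; split; first by lra.
  by move=> ult; have := W1 _; rewrite mulrC => /(_ ult); lra.
Qed.

Lemma sturm_comparison_pos c d a b1 b2 m1 m2 u g v h s t :
  increasing c d a -> solves c d a b1 m1 u g -> solves c d a b2 m2 v h ->
  (forall x, c < x < d -> omg a b1 x != 0) ->
  (forall x, c < x < d -> omg a b2 x != 0) ->
  (forall x, c < x < d -> ~ vanishes u g x) ->
  (forall x, c < x < d -> ~ vanishes v h x) ->
  c < s -> s < t -> t < d -> pos_right u s -> pos_right v s ->
  (forall x, s < x < t -> 0 < fl u x * fr u x) ->
  (forall x y, s <= x -> x < y -> y <= t -> inc b2 x y <= inc b1 x y) ->
  (forall x, s < x < t -> jmp b2 x <= jmp b1 x) ->
  (forall x, s < x < t -> ~ switches v x) ->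
  fr u s = 0 \/ [/\ fl u s * fr u s <= 0, 0 < omg a b1 s, jmp b2 s <= jmp b1 s
    & ~ switches v s] ->
  fl u t = 0 \/ [/\ fl u t * fr u t <= 0, 0 < omg a b1 t, jmp b2 t <= jmp b1 t
    & ~ switches v t] ->
  ~ (fl u s * fr u s < 0 \/ fl u t * fr u t < 0).
Proof.
move=> ainc uS vS w1 w2 uz vz cs st td us vs uu b21 j21 vsw es et.
have scd : c < s < d by apply/andP; split; lra.
have tcd : c < t < d by apply/andP; split; lra.
have usw x : s < x < t -> ~ switches u x.
  move=> xst; have xcd : c < x < d by case/andP: xst => ? ?; apply/andP; split; lra.
  have := uu _ xst; rewrite ltNge => /negP uux.
  case=> -[ul ur]; apply: uux.
    have l0 := pos_left_ge0 (solves_reg uS) xcd ul.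
    have := pos_right_ge0 (solves_reg (solves_negs uS)) xcd ur.
    by rewrite /= oppr_ge0; exact: mulr_ge0_le0.
  have r0 := pos_right_ge0 (solves_reg uS) xcd ur.
  have := pos_left_ge0 (solves_reg (solves_negs uS)) xcd ul.
  by rewrite /= oppr_ge0 => l0; exact: mulr_le0_ge0.
have [ul ur] := nonneg_of_no_switch ainc uS w1 uz cs st td usw us.
have [vl vr] := nonneg_of_no_switch ainc vS w2 vz cs st td vsw vs.
have ut := pos_left_of_no_switch ainc uS w1 uz cs st td usw us.
have vt := pos_left_of_no_switch ainc vS w2 vz cs st td vsw vs.
have W := wronskian_decreases ainc uS vS cs st td b21 j21 ul ur vl vr.
have [|Ws Ws'] := wronskian_left_end ainc uS vS scd (vz _ scd) us vs.
  case: es => [->|[ulr w0 j0 vss]]; [by left|right; split=> //].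
  (* As [v] is positive to the right of [s], a negative germ on the left would be a switch at
     [s]. *)
  have [vsl|vsl] := pos_left_or_negs ainc vS scd (w2 _ scd) (vz _ scd).
    exact: pos_left_ge0 (solves_reg vS) scd vsl.
  by case: vss; right.
have [|Wt Wt'] := wronskian_right_end ainc uS vS tcd (vz _ tcd) ut vt.
  case: et => [->|[ulr w0 j0 vtt]]; [by left|right; split=> //].
  have [vtr|vtr] := pos_right_or_negs ainc vS tcd (w2 _ tcd) (vz _ tcd).
    exact: pos_right_ge0 (solves_reg vS) tcd vtr.
  by case: vtt; left.
by case=> [/Ws'|/Wt']; lra.
Qed.

Lemma solves_pos_right c d a b m u g s : increasing c d a ->
  solves c d a b m u g -> (forall x, c < x < d -> omg a b x != 0) ->
  (forall x, c < x < d -> ~ vanishes u g x) -> c < s < d ->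
  exists u' g', [/\ solves c d a b m u' g',
    forall x, c < x < d -> ~ vanishes u' g' x, pos_right u' s
    & u' = u \/ u' = negs u].
Proof.
move=> ainc uS w0 uz scd.
have [us|us] := pos_right_or_negs ainc uS scd (w0 _ scd) (uz _ scd).
  by exists u, g; split => //; left.
exists (negs u), (negs g); split => //; last by right.
  exact: solves_negs.
move=> x /uz nz [/= /eqP + /eqP]; rewrite !oppr_eq0 => /eqP u0 /eqP g0.
exact: nz.
Qed.

(** [u] enters through products of its two limits and equalities to 0, [v] through [switches]; all
    are invariant under a change of sign, so each function can be negated independently. *)
Lemma sturm_comparison c d a b1 b2 m1 m2 u g v h s t :
  increasing c d a -> solves c d a b1 m1 u g -> solves c d a b2 m2 v h ->
  (forall x, c < x < d -> omg a b1 x != 0) ->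
  (forall x, c < x < d -> omg a b2 x != 0) ->
  (forall x, c < x < d -> ~ vanishes u g x) ->
  (forall x, c < x < d -> ~ vanishes v h x) ->
  c < s -> s < t -> t < d ->
  (forall x, s < x < t -> 0 < fl u x * fr u x) ->
  (forall x y, s <= x -> x < y -> y <= t -> inc b2 x y <= inc b1 x y) ->
  (forall x, s < x < t -> jmp b2 x <= jmp b1 x) ->
  (forall x, s < x < t -> ~ switches v x) ->
  fr u s = 0 \/ [/\ fl u s * fr u s <= 0, 0 < omg a b1 s, jmp b2 s <= jmp b1 s
    & ~ switches v s] ->
  fl u t = 0 \/ [/\ fl u t * fr u t <= 0, 0 < omg a b1 t, jmp b2 t <= jmp b1 t
    & ~ switches v t] ->
  ~ (fl u s * fr u s < 0 \/ fl u t * fr u t < 0).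
Proof.
move=> ainc uS vS w1 w2 uz vz cs st td uu b21 j21 vsw es et.
have scd : c < s < d by apply/andP; split; lra.
have [u' [g' [uS' uz' us' Eu]]] := solves_pos_right ainc uS w1 uz scd.
have [v' [h' [vS' vz' vs' Ev]]] := solves_pos_right ainc vS w2 vz scd.
have uE x : fl u' x * fr u' x = fl u x * fr u x.
  by case: Eu => ->; rewrite //= mulrNN.
have vE x : ~ switches v x -> ~ switches v' x.
  by move=> nv; case: Ev => -> // /switches_negs.
rewrite -!uE.
apply: (sturm_comparison_pos ainc uS' vS' w1 w2 uz' vz' cs st td us' vs') => //.
- by move=> x /uu; rewrite uE.
- by move=> x /vsw; exact: vE.
- case: es => [u0|[? ? ? ?]]; [left|right; rewrite uE; split => //; exact: vE].
  by case: Eu => ->; rewrite //= u0 oppr0.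
- case: et => [u0|[? ? ? ?]]; [left|right; rewrite uE; split => //; exact: vE].
  by case: Eu => ->; rewrite //= u0 oppr0.
Qed.

End WronskianMonotone.

(** * One-sided limits of functions of bounded variation *)

Section SidesOfBVFunctions.
Context {R : realType}.
Implicit Types (f : R -> R) (a b : \bar R) (c d x y : R).

Definition sides f := Sided (llim f) f (rlim f).

Lemma cvg_dist_le (F : set_system R) {FF : ProperFilter F} f (l r e : R) :
  f @ F --> l -> (\forall t \near F, `|f t - r| <= e) -> `|l - r| <= e.
Proof.
move=> /cvgrPdist_le fl fr; apply/ler_addgt0Pr => eta eta0; near F => t.
have h1 : `|l - f t| <= eta by near: t; exact: fl.
have h2 : `|f t - r| <= e by near: t.
by rewrite -(subrKA (f t)) (le_trans (ler_normD _ _))// addrC lerD.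
Unshelve. all: by end_near. Qed.

Lemma nondecreasing_cvg_sides f c d x :
  (forall p q, c <= p -> p <= q -> q <= d -> f p <= f q) ->
  c < x < d -> cvg (f t @[t --> x^'-]) /\ cvg (f t @[t --> x^'+]).
Proof.
move=> ndf /andP[cx xd]; split.
- apply: nondecreasing_at_left_is_cvgr; near=> y.
    have cy : c <= y by near: y; exact: nbhs_left_ge.
    move=> p q; rewrite !in_itv /= => /andP[yp px] /andP[yq qx] pq.
    by apply: ndf => //; lra.
  have cy : c <= y by near: y; exact: nbhs_left_ge.
  exists (f x) => _ /= [z + <-]; rewrite in_itv /= => /andP[yz zx].
  by apply: ndf; lra.
- apply: nondecreasing_at_right_is_cvgr; near=> y.
    have yd : y <= d by near: y; exact: nbhs_right_le.
    move=> p q; rewrite !in_itv /= => /andP[yp px] /andP[yq qx] pq.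
    by apply: ndf => //; lra.
  have yd : y <= d by near: y; exact: nbhs_right_le.
  exists (f x) => _ /= [z + <-]; rewrite in_itv /= => /andP[yz zx].
  by apply: ndf; lra.
Unshelve. all: by end_near. Qed.

Lemma bounded_variation_cvg_sides f c d x : bounded_variation c d f ->
  c < x < d -> f t @[t --> x^'-] --> llim f x /\ f t @[t --> x^'+] --> rlim f x.
Proof.
move=> bv xcd; case/andP: (xcd) => cx xd.
pose p := fine \o pos_tv c f; pose n := fine \o neg_tv c f.
have [pl pr] : cvg (p t @[t --> x^'-]) /\ cvg (p t @[t --> x^'+]).
  apply: (nondecreasing_cvg_sides (c := c) (d := d)) => // y z cy yz zd.
  (* The positive variation of [f] is the negative variation of its opposite. *)
  apply: (fine_neg_tv_nondecreasing (bounded_variationN bv)) => //;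
    by rewrite in_itv /=; apply/andP; split; lra.
have [nl nr] : cvg (n t @[t --> x^'-]) /\ cvg (n t @[t --> x^'+]).
  apply: (nondecreasing_cvg_sides (c := c) (d := d)) => // y z cy yz zd.
  apply: (fine_neg_tv_nondecreasing bv) => //;
    by rewrite in_itv /=; apply/andP; split; lra.
have fE y : c <= y -> y <= d -> f y = p y - n y.
  move=> cy yd; apply: (bounded_variation_pos_neg_tvE bv).
  by rewrite in_itv /= cy.
split; [suff: cvg (f t @[t --> x^'-]) by []|suff: cvg (f t @[t --> x^'+]) by []].
- apply/cvg_ex; eexists; apply: cvg_trans (cvgB pl nl); apply: near_eq_cvg.
  near=> y; have yx : y < x by near: y; exact: nbhs_left_lt.
  have cy : c <= y by near: y; exact: nbhs_left_ge.
  by rewrite !fctE fE//; lra.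
- apply/cvg_ex; eexists; apply: cvg_trans (cvgB pr nr); apply: near_eq_cvg.
  near=> y; have xy : x < y by near: y; exact: nbhs_right_gt.
  have yd : y <= d by near: y; exact: nbhs_right_le.
  by rewrite !fctE fE//; lra.
Unshelve. all: by end_near. Qed.

(** On a short interval beside [x] all values of [f] are within [e] of the limit, and one-sided
    limits at interior points inherit the bound. *)
Lemma regulated_sides f c d : bounded_variation c d f -> regulated c d (sides f).
Proof.
move=> bv x xcd e e0; case/andP: (xcd) => cx xd.
have [/cvgrPdist_le/(_ _ e0) hl /cvgrPdist_le/(_ _ e0) hr] :=
  bounded_variation_cvg_sides bv xcd.
have hr' : \forall t \near x^'+, `|f t - rlim f x| <= e.
  by apply: filterS hr => t; rewrite distrC.
have hl' : \forall t \near x^'-, `|f t - llim f x| <= e.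
  by apply: filterS hl => t; rewrite distrC.
split.
- near x^'+ => y.
  have xy : x < y by near: y; exact: nbhs_right_gt.
  have yd : y <= d by near: y; exact: nbhs_right_le.
  have hy t : x < t < y -> `|f t - rlim f x| <= e.
    by move: t; near: y; exact: near_right_itv hr'.
  apply: (near_right_of_itv xy) => t xty; case/andP: (xty) => xt ty.
  have tcd : c < t < d by apply/andP; split; lra.
  have [fl fr] := bounded_variation_cvg_sides bv tcd.
  split; last 2 [exact: hy].
  + apply: (cvg_dist_le fl); apply: (near_left_of_itv xt) => z /andP[xz zt].
    by apply: hy; rewrite xz (lt_trans zt).
  + apply: (cvg_dist_le fr); apply: (near_right_of_itv ty) => z /andP[tz zy].
    by apply: hy; rewrite zy (lt_trans xt).
- near x^'- => y.
  have yx : y < x by near: y; exact: nbhs_left_lt.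
  have cy : c <= y by near: y; exact: nbhs_left_ge.
  have hy t : y < t < x -> `|f t - llim f x| <= e.
    by move: t; near: y; exact: near_left_itv hl'.
  apply: (near_left_of_itv yx) => t ytx; case/andP: (ytx) => yt tx.
  have tcd : c < t < d by apply/andP; split; lra.
  have [fl fr] := bounded_variation_cvg_sides bv tcd.
  split; last 2 [exact: hy].
  + apply: (cvg_dist_le fl); apply: (near_left_of_itv yt) => z /andP[yz zt].
    by apply: hy; rewrite yz (lt_trans zt).
  + apply: (cvg_dist_le fr); apply: (near_right_of_itv tx) => z /andP[tz zx].
    by apply: hy; rewrite zx (lt_trans yt).
Unshelve. all: by end_near. Qed.

Lemma cptsub_extend a b c d : (a < c%:E)%E -> c <= d -> (d%:E < b)%E ->
  exists c' d', [/\ cptsub a b c' d', c' < c & d < d'].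
Proof.
move=> ac cd db.
have [c' ac' cc'] : exists2 c', (a < c'%:E)%E & c' < c.
  case: a ac => [r||]//= ac.
    by rewrite lte_fin in ac; exists ((r + c) / 2); rewrite ?lte_fin midf_lt.
  by exists (c - 1); rewrite ?ltNyr// ltrBlDr ltrDl.
have [d' db' dd'] : exists2 d', (d'%:E < b)%E & d < d'.
  case: b db => [r||]//= db.
    by rewrite lte_fin in db; exists ((d + r) / 2); rewrite ?lte_fin midf_lt.
  by exists (d + 1); rewrite ?ltry// ltrDl.
by exists c', d'; split => //; split => //; lra.
Qed.

End SidesOfBVFunctions.

(** * Masses of points and intervals under a Stieltjes charge *)

Section StieltjesChargeOfIntervals.
Context {R : realType} (a b : \bar R) (c d : R) (cd : cptsub a b c d).
Implicit Types (f h g : R -> R).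

Definition gaugeof f x y := fine (charge_variation (hahnP (dmeas f c d)) `]x, y[).

Lemma fin_dmeas f A : measurable A -> dmeas f c d A \is a fin_num.
Proof. by move=> mA; exact: fin_num_measure. Qed.

Let fin_var f A : measurable A ->
  charge_variation (hahnP (dmeas f c d)) A \is a fin_num.
Proof. exact: fin_charge_variation. Qed.

Lemma le_charge_variation f (A B : set R) : measurable A -> measurable B ->
  A `<=` B -> fine (charge_variation (hahnP (dmeas f c d)) A) <=
              fine (charge_variation (hahnP (dmeas f c d)) B).
Proof.
move=> mA mB AB; apply: fine_le; [exact: fin_var|exact: fin_var|].
by apply: le_measure; rewrite ?inE.
Qed.

Lemma gaugeof_right f x e : 0 < e -> \forall y \near x^'+, gaugeof f x y <= e.
Proof.
move=> e0; apply: filterS (measure_itvoc_right (@fin_var f) x e0) => y.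
apply: le_trans; apply: le_charge_variation; try exact: measurable_itv.
exact: subset_itv_oo_oc.
Qed.

Lemma gaugeof_left f x e : 0 < e -> \forall y \near x^'-, gaugeof f y x <= e.
Proof.
move=> e0; apply: filterS (measure_itvco_left (@fin_var f) x e0) => y.
apply: le_trans; apply: le_charge_variation; try exact: measurable_itv.
exact: subset_itv_oo_co.
Qed.

Lemma dmeas_co_split f x y : x < y -> fine (dmeas f c d `[x, y[) =
  fine (dmeas f c d [set x]) + fine (dmeas f c d `]x, y[).
Proof.
move=> xy; rewrite -fineD ?fin_dmeas//; try exact: measurable_itv.
rewrite -[in LHS](setU1itv false) ?bnd_simp//.
congr fine; apply: chargeU => //.
by rewrite -subset0 => z [/= ->]; rewrite in_itv /= ltxx.
Qed.

Lemma norm_dmeas_oo f x y : `|fine (dmeas f c d `]x, y[)| <= gaugeof f x y.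
Proof. by apply: normr_charge_le; exact: measurable_itv. Qed.

Context f (bvf : BVloc a b f).

Let dmeas_co x y : c <= x -> x < y -> y <= d ->
  dmeas f c d `[x, y[ = (llim f y - llim f x)%:E.
Proof. exact: (dmeasP bvf cd).2. Qed.

(** Only intervals [[x, y[] have a prescribed mass. As y decreases to x, that mass tends to the jump
    while the variation of []x, y[] tends to 0. *)
Lemma dmeas_set1 x : c < x < d -> fine (dmeas f c d [set x]) = jmp (sides f) x.
Proof.
move=> xcd; case/andP: (xcd) => cx xd.
suff H : `|fine (dmeas f c d [set x]) - jmp (sides f) x| <= 0.
  by apply/eqP; rewrite -subr_eq0 -normr_le0.
apply/ler_addgt0Pr => e e0; rewrite add0r.
have e2 : 0 < e / 2 by rewrite divr_gt0.
have [fr _] := regulated_sides (bvf cd) xcd e2.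
near x^'+ => y.
have xy : x < y by near: y; exact: nbhs_right_gt.
have yd : y <= d by near: y; exact: nbhs_right_le.
have := dmeas_co_split f xy; rewrite (dmeas_co (ltW cx) xy yd) /=.
have [+ _ _] : [/\ `|llim f y - rlim f x| <= e / 2,
  `|f y - rlim f x| <= e / 2 & `|rlim f y - rlim f x| <= e / 2] by near: y.
have : gaugeof f x y <= e / 2 by near: y; exact: gaugeof_right.
move/(le_trans (norm_dmeas_oo f x y)); rewrite /jmp /= !ler_norml.
by move=> /andP[? ?] /andP[? ?] ?; apply/andP; split; lra.
Unshelve. all: by end_near. Qed.

Lemma dmeas_oo x y : c < x -> x < y -> y < d ->
  fine (dmeas f c d `]x, y[) = inc (sides f) x y.
Proof.
move=> cx xy yd; have := dmeas_co_split f xy; rewrite (dmeas_co (ltW cx) xy (ltW yd)) /=.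
rewrite dmeas_set1; last by rewrite cx (lt_trans xy).
by rewrite /jmp /inc /=; lra.
Qed.

Lemma gauge_dmeas : gauge c d (sides f) (gaugeof f).
Proof.
split.
- by move=> x y cx xy yd; rewrite -dmeas_oo//; exact: norm_dmeas_oo.
- move=> x z y cx xz zy yd; rewrite /gaugeof -fineD ?fin_var//; try exact: measurable_itv.
  rewrite -measureU; try exact: measurable_itv.
    apply: le_charge_variation; try exact: measurable_itv.
      by apply: measurableU; exact: measurable_itv.
    move=> w [] /=; rewrite !in_itv /= => /andP[? ?]; apply/andP; split; lra.
  rewrite -subset0 => w [] /=; rewrite !in_itv /= => /andP[_ wz] /andP[zw _].
  by rewrite ltNge (ltW wz) in zw.
- by move=> x e _; exact: gaugeof_right.
- by move=> x e _; exact: gaugeof_left.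
Qed.

Lemma dmeas_itv_ge0 x y : (forall x y, c <= x -> x < y -> y <= d -> llim f x <= llim f y) ->
  x < y -> (0 <= dmeas f c d `[x, y[)%E.
Proof.
move=> ndf xy; rewrite ((dmeasP bvf cd).1 _ (measurable_itv _)).
have -> : `[x, y[ `&` `[c, d[ = `[Num.max x c, Num.min y d[%classic.
  apply/seteqP; split=> z /=; rewrite !in_itv /= ge_max lt_min.
    by move=> [/andP[-> ->] /andP[-> ->]].
  by move=> /andP[/andP[-> ->] /andP[-> ->]].
have [xyE|xyE] := ltP (Num.max x c) (Num.min y d).
  rewrite dmeas_co// ?lee_fin ?subr_ge0 ?ndf// ?le_max ?lexx ?orbT// ge_min lexx ?orbT//.
by rewrite set_itv_ge ?charge0// bnd_simp -leNgt.
Qed.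

(** [charge_ge0_of_itv] asks for intervals []x, y]], whereas the hypothesis controls [[x, y[].
    Points and open intervals are treated first, each up to a short open interval of small
    variation. *)
Lemma dmeas_ge0 A :
  (forall x y, c <= x -> x < y -> y <= d -> llim f x <= llim f y) ->
  measurable A -> (0 <= dmeas f c d A)%E.
Proof.
move=> ndf; have ge0 x y : x < y -> 0 <= fine (dmeas f c d `[x, y[).
  by move=> xy; rewrite fine_ge0// dmeas_itv_ge0.
have ge0_1 x : 0 <= fine (dmeas f c d [set x]).
  apply/ler_addgt0Pr => e e0; near x^'+ => y.
  have xy : x < y by near: y; exact: nbhs_right_gt.
  have : gaugeof f x y <= e by near: y; exact: gaugeof_right.
  move/(le_trans (norm_dmeas_oo f x y)); rewrite ler_norml => /andP[_ ?].
  by have := ge0 _ _ xy; rewrite dmeas_co_split//; lra.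
have ge0_oo x y : x < y -> 0 <= fine (dmeas f c d `]x, y[).
  move=> xy; apply/ler_addgt0Pr => e e0; near x^'+ => z.
  have xz : x < z by near: z; exact: nbhs_right_gt.
  have zy : z < y by near: z; exact: nbhs_right_lt.
  have : gaugeof f x z <= e by near: z; exact: gaugeof_right.
  move/(le_trans (norm_dmeas_oo f x z)); rewrite ler_norml => /andP[? _].
  have -> : `]x, y[%classic = `]x, z[ `|` `[z, y[ :> set R.
    by rewrite -itv_bndbnd_setU// bnd_simp// ltW.
  have -> : dmeas f c d (`]x, z[ `|` `[z, y[) =
      (dmeas f c d `]x, z[ + dmeas f c d `[z, y[)%E.
    apply: chargeU; try exact: measurable_itv.
    rewrite -subset0 => w [] /=; rewrite !in_itv /= => /andP[_ wz] /andP[zw _].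
    by rewrite ltNge zw in wz.
  rewrite fineD ?fin_dmeas//; try exact: measurable_itv.
  by have := ge0 _ _ zy; lra.
move=> mA; apply: charge_ge0_of_itv mA => x y.
rewrite le_eqVlt => /predU1P[->|xy]; first by rewrite set_itvoc0 charge0.
rewrite -(setUitv1 true) ?bnd_simp//.
have -> : dmeas f c d (`]x, y[ `|` [set y]) =
    (dmeas f c d `]x, y[ + dmeas f c d [set y])%E.
  apply: chargeU => //.
  rewrite -subset0 => w [] /=; rewrite in_itv /= => /andP[_ wy] wE.
  by rewrite wE ltxx in wy.
by apply: adde_ge0; rewrite -(fineK (fin_dmeas _ _)) ?lee_fin ?ge0_1 ?ge0_oo.
Unshelve. all: by end_near. Qed.

(** The part of [A] in the negative Hahn set has mass both nonpositive and nonnegative. For alpha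
    this identifies the gauge with [inc], as [solves] requires. *)
Lemma charge_variation_dmeas A :
  (forall x y, c <= x -> x < y -> y <= d -> llim f x <= llim f y) ->
  measurable A -> charge_variation (hahnP (dmeas f c d)) A = dmeas f c d A.
Proof.
move=> ndf mA; have [_ [mN nN] _ _] := hahnP (dmeas f c d).
have nAN : dmeas f c d (A `&` hahn_neg (dmeas f c d)) = 0.
  have mAN : measurable (A `&` hahn_neg (dmeas f c d)) by exact: measurableI.
  by apply/eqP; rewrite eq_le nN//= dmeas_ge0.
have n0 : jordan_neg (hahnP (dmeas f c d)) A = 0.
  by rewrite jordan_negE cjordan_negE /crestr0 mem_set//= /crestr nAN oppe0.
rewrite [RHS](jordan_decomp (hahnP (dmeas f c d)) mA) /charge_variation /= /cadd /=.
rewrite cscaleN1 n0; congr (_ + _)%E.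
exact: esym (etrans (congr1 oppe n0) oppe0).
Qed.

End StieltjesChargeOfIntervals.

(** * From balanced solutions to the numerical system *)

Section SystemOfBalancedSolution.
Context {R : realType} (a b : \bar R) (c d : R) (cd : cptsub a b c d).
Implicit Types (f g h : R -> R).

Lemma density_dmeas f g h : BVloc a b f -> BVloc a b g -> has_density a b f g h ->
  density c d (sides f) (sides h) (sides g) (gaugeof c d g).
Proof.
move=> bvf bvg [hint hE].
have key A k e : measurable A -> A `<=` `[c, d[ ->
    (forall z, A z -> `|h z - k| <= e) ->
    `|fine (dmeas f c d A) - k * fine (dmeas g c d A)| <=
      e * fine (charge_variation (hahnP (dmeas g c d)) A).
  move=> mA Acd hk; rewrite (hE _ _ cd _ mA Acd).
  apply: (charge_integral_dist_cst_le mA _ hk).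
  exact: (integrableS (measurable_itv _) mA Acd (hint _ _ cd)).
split=> [x xcd|x y k e cx xy yd hk].
  rewrite -(dmeas_set1 cd bvf xcd) -(dmeas_set1 cd bvg xcd).
  have : `|fine (dmeas f c d [set x]) - h x * fine (dmeas g c d [set x])| <=
      0 * fine (charge_variation (hahnP (dmeas g c d)) [set x]).
    apply: key => //.
      by move=> z /= ->; rewrite in_itv /=; case/andP: xcd => /ltW -> ->.
    by move=> z /= ->; rewrite subrr normr0.
  by rewrite mul0r normr_le0 subr_eq0 => /eqP.
rewrite -(dmeas_oo cd bvf cx xy yd) -(dmeas_oo cd bvg cx xy yd).
apply: key => [| |z]; first exact: measurable_itv.
  by move=> z; rewrite /= !in_itv /= => /andP[xz zy]; apply/andP; split; lra.
by rewrite /= in_itv /=; exact: hk.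
Qed.

Lemma measure_eq0_density f h g : measure_eq0 a b f h g -> has_density a b f g h.
Proof.
move=> [hint hE]; split=> // c' d' cd' A mA Acd.
move: (fin_num_measure (dmeas f c' d') A mA) (hE _ _ cd' _ mA Acd).
case: (dmeas f c' d' A) => [r||]//= _; case: (charge_integral _ _ _) => [q||]//=.
by move=> [] ?; congr EFin; lra.
Qed.

Lemma solves_of_balanced alpha beta u : BVloc a b alpha -> BVloc a b beta ->
  (forall x y, c < x -> x < y -> y < d -> gaugeof c d alpha x y = inc (sides alpha) x y) ->
  balanced_solution a b alpha beta u ->
  exists g, solves c d (sides alpha) (sides beta) (gaugeof c d beta)
    (sides u) (sides g).
Proof.
move=> bva bvb gE [[bvu mu] _ [g [[bvg mg] du /measure_eq0_density dg]]].
have inab x : c < x < d -> ointv a b x.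
  move=> /andP[cx xd]; case: cd => ac _ db; split.
    by apply: lt_trans ac _; rewrite lte_fin.
  by apply: lt_trans db; rewrite lte_fin.
exists g; split.
- exact: regulated_sides (bvu _ _ cd).
- exact: regulated_sides (bvg _ _ cd).
- by move=> x /inab /mu.
- by move=> x /inab /mg.
- exact (gauge_dmeas cd bvb).
- have [ju iu] := density_dmeas bvu bva du; split=> // x y k e cx xy yd hk.
  by have := iu _ _ _ _ cx xy yd hk; rewrite gE.
- exact: density_dmeas bvg bvb dg.
Qed.

End SystemOfBalancedSolution.

(** * The strictly increasing integrator *)

Section IncreasingIntegrator.
Context {R : realType} (a b : \bar R) (alpha : R -> R).
Hypothesis alpha_incr : forall x y, ointv a b x -> ointv a b y -> x < y ->
  alpha x < alpha y.

Let inab c d x : cptsub a b c d -> c <= x -> x <= d -> ointv a b x.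
Proof.
move=> [ac _ db] cx xd; split; first by apply: lt_le_trans ac _; rewrite lee_fin.
by apply: le_lt_trans db; rewrite lee_fin.
Qed.

Lemma BVloc_increasing : BVloc a b alpha.
Proof.
move=> c d cd; apply: nondecreasing_bounded_variation => x y.
rewrite !in_itv /= => /andP[cx xd] /andP[cy yd].
rewrite le_eqVlt => /predU1P[->//|xy].
by apply/ltW/alpha_incr => //; exact: inab cd _ _.
Qed.

Let cvgs c d x : cptsub a b c d -> c < x < d ->
  alpha t @[t --> x^'-] --> llim alpha x /\ alpha t @[t --> x^'+] --> rlim alpha x.
Proof. by move=> cd; exact/bounded_variation_cvg_sides/BVloc_increasing. Qed.

Let llim_le c d x : cptsub a b c d -> c < x < d -> llim alpha x <= alpha x.
Proof.
move=> cd xcd; case/andP: (xcd) => cx xd; have [/cvgP/limr_le + _] := cvgs cd xcd.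
apply; near=> t.
have tx : t < x by near: t; exact: nbhs_left_lt.
have ct : c < t by near: t; exact: nbhs_left_gt.
by apply/ltW/alpha_incr => //; apply: (inab cd); lra.
Unshelve. all: by end_near. Qed.

Let le_rlim c d x : cptsub a b c d -> c < x < d -> alpha x <= rlim alpha x.
Proof.
move=> cd xcd; case/andP: (xcd) => cx xd; have [_ /cvgP/limr_ge +] := cvgs cd xcd.
apply; near=> t.
have xt : x < t by near: t; exact: nbhs_right_gt.
have td : t < d by near: t; exact: nbhs_right_lt.
by apply/ltW/alpha_incr => //; apply: (inab cd); lra.
Unshelve. all: by end_near. Qed.

Let le_llim c d x y : cptsub a b c d -> c < x -> x < y -> y < d ->
  alpha x <= llim alpha y.
Proof.
move=> cd cx xy yd; have ycd : c < y < d by rewrite (lt_trans cx).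
have [/cvgP/limr_ge + _] := cvgs cd ycd.
apply; near=> t.
have xt : x < t by near: t; exact: nbhs_left_gt.
have ty : t < y by near: t; exact: nbhs_left_lt.
by apply/ltW/alpha_incr => //; apply: (inab cd); lra.
Unshelve. all: by end_near. Qed.

Let rlim_le c d x y : cptsub a b c d -> c < x -> x < y -> y < d ->
  rlim alpha x <= alpha y.
Proof.
move=> cd cx xy yd; have xcd : c < x < d by rewrite cx (lt_trans xy).
have [_ /cvgP/limr_le +] := cvgs cd xcd.
apply; near=> t.
have xt : x < t by near: t; exact: nbhs_right_gt.
have ty : t < y by near: t; exact: nbhs_right_lt.
by apply/ltW/alpha_incr => //; apply: (inab cd); lra.
Unshelve. all: by end_near. Qed.

Lemma increasing_sides c d : cptsub a b c d -> increasing c d (sides alpha).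
Proof.
move=> cd; split; first exact: regulated_sides (BVloc_increasing cd).
  move=> x xcd; rewrite /jmp /=.
  by have := llim_le cd xcd; have := le_rlim cd xcd; lra.
move=> x y cx xy yd; rewrite /inc /=.
(* Two intermediate points: a single one would only give a weak inequality between the limits. *)
pose p := x + (y - x) / 3; pose q := x + 2 * (y - x) / 3.
have xp : x < p by rewrite /p; lra.
have pq : p < q by rewrite /p /q; lra.
have qy : q < y by rewrite /q; lra.
have h1 : rlim alpha x <= alpha p by apply: (rlim_le cd) => //; lra.
have h2 : alpha q <= llim alpha y by apply: (le_llim cd) => //; lra.
have : alpha p < alpha q by apply: alpha_incr => //; apply: (inab cd); lra.
by lra.
Qed.

Lemma gaugeof_increasing c d x y : cptsub a b c d -> c < x -> x < y -> y < d ->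
  gaugeof c d alpha x y = inc (sides alpha) x y.
Proof.
move=> cd cx xy yd; rewrite /gaugeof (charge_variation_dmeas cd BVloc_increasing).
- exact (dmeas_oo cd BVloc_increasing cx xy yd).
(* Here [p = c] and [q = d] are allowed, so a larger compact interval is needed to have both in its
   interior. *)
- move=> p q cp pq qd; case: (cd) => ac cd' db.
  have [c' [d' [cd1 c'c dd']]] := cptsub_extend ac (ltW cd') db.
  have pcd : c' < p < d' by apply/andP; split; lra.
  apply: (le_trans (llim_le cd1 pcd)).
  by apply: (le_llim cd1) => //; lra.
- exact: measurable_itv.
Qed.

End IncreasingIntegrator.

(** * Consequences of positivity of the difference measure *)

Section PositiveDifference.
Context {R : realType} (a b : \bar R) (c d : R) (cd : cptsub a b c d).
Implicit Types (f g : R -> R) (I : set R).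

Lemma BVlocB f g : BVloc a b f -> BVloc a b g -> BVloc a b (f \- g).
Proof.
move=> bvf bvg c' d' cd'; case: (cd') => _ cd1 _.
exact: bounded_variationD cd1 (bvf _ _ cd') (bounded_variationN (bvg _ _ cd')).
Qed.

Let sidesB f g x : BVloc a b f -> BVloc a b g -> c < x < d ->
  llim (f \- g) x = llim f x - llim g x /\ rlim (f \- g) x = rlim f x - rlim g x.
Proof.
move=> bvf bvg xcd.
have [fl fr] := bounded_variation_cvg_sides (bvf _ _ cd) xcd.
have [gl gr] := bounded_variation_cvg_sides (bvg _ _ cd) xcd.
by split; apply/cvg_lim => //; [exact: cvgB fl gl|exact: cvgB fr gr].
Qed.

Lemma positive_on_inc f g I x y : BVloc a b f -> BVloc a b g ->
  positive_on a b (f \- g) I -> c < x -> x < y -> y < d -> `]x, y[ `<=` I ->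
  inc (sides g) x y <= inc (sides f) x y.
Proof.
move=> bvf bvg /(_ _ _ cd)[_ pos] cx xy yd sub.
have /fine_ge0 := pos _ (measurable_itv _) sub.
rewrite (dmeas_oo cd (BVlocB bvf bvg) cx xy yd) /inc /=.
have xcd : c < x < d by rewrite cx (lt_trans xy).
have ycd : c < y < d by rewrite (lt_trans cx).
have [_ ->] := sidesB bvf bvg xcd; have [-> _] := sidesB bvf bvg ycd.
by lra.
Qed.

Lemma positive_on_jmp f g I x : BVloc a b f -> BVloc a b g ->
  positive_on a b (f \- g) I -> c < x < d -> I x ->
  jmp (sides g) x <= jmp (sides f) x.
Proof.
move=> bvf bvg /(_ _ _ cd)[_ pos] xcd Ix.
have /fine_ge0 : (0 <= dmeas (f \- g)%R c d [set x])%E.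
  by apply: pos => // z ->.
rewrite (dmeas_set1 cd (BVlocB bvf bvg) xcd) /jmp /=.
by have [-> ->] := sidesB bvf bvg xcd; lra.
Qed.

End PositiveDifference.

(** * Sign changes and the five cases *)

Lemma switches_changes_sign (R : realType) (v : R -> R) (x : R) :
  switches (sides v) x -> changes_sign_at v x.
Proof.
have right (P : R -> Prop) : (\forall t \near x^'+, P t) ->
    exists2 e, 0 < e & forall t, x < t < x + e -> P t.
  move=> [e /= e0 he]; exists e => // t /andP[xt te]; apply: he => //=.
  by rewrite ltr0_norm ?subr_lt0//; lra.
have left (P : R -> Prop) : (\forall t \near x^'-, P t) ->
    exists2 e, 0 < e & forall t, x - e < t < x -> P t.
  move=> [e /= e0 he]; exists e => // t /andP[xt te]; apply: he => //=.
  by rewrite gtr0_norm ?subr_gt0//; lra.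
have itvs e1 e2 t : (x - Num.min e1 e2 < t < x -> x - e1 < t < x) /\
    (x < t < x + Num.min e1 e2 -> x < t < x + e2).
  have h1 : Num.min e1 e2 <= e1 by rewrite ge_min lexx.
  have h2 : Num.min e1 e2 <= e2 by rewrite ge_min lexx orbT.
  by split=> /andP[? ?]; apply/andP; split; lra.
case=> -[/left[e1 e10 h1] /right[e2 e20 h2]];
  exists (Num.min e1 e2); rewrite ?lt_min ?e10//; [right|left]; split=> t xt.
- by have [] := h1 _ ((itvs e1 e2 t).1 xt).
- by have [_] := h2 _ ((itvs e1 e2 t).2 xt); rewrite /= oppr_gt0.
- by have [] := h1 _ ((itvs e1 e2 t).1 xt); rewrite /= oppr_gt0.
- by have [] := h2 _ ((itvs e1 e2 t).2 xt).
Qed.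

Theorem theorem6p4 (R : realType) (a b : \bar R) (ab : (a < b)%E)
  (alpha beta1 beta2 : R -> R)
  (alpha_incr : forall x y, ointv a b x -> ointv a b y -> x < y ->
     alpha x < alpha y)
  (beta1_BV : BVloc a b beta1) (beta2_BV : BVloc a b beta2)
  (omega1_neq0 : forall x, ointv a b x -> omega alpha beta1 x != 0)
  (omega2_neq0 : forall x, ointv a b x -> omega alpha beta2 x != 0)
  (u v : R -> R)
  (u_sol : balanced_solution a b alpha beta1 u) (u_nt : nontrivial a b u)
  (v_sol : balanced_solution a b alpha beta2 v) (v_nt : nontrivial a b v)
  (s t : R) (st : consecutive_zeros a b u s t) :
  [/\ (llim u s * rlim u s < 0 -> llim u t = 0 ->
       0 < omega alpha beta1 s ->
       positive_on a b (beta1 \- beta2) `[s, t[ ->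
       changes_sign_in v `[s, t[),
      (rlim u s = 0 -> llim u t * rlim u t < 0 ->
       0 < omega alpha beta1 t ->
       positive_on a b (beta1 \- beta2) `]s, t] ->
       changes_sign_in v `]s, t]),
      (llim u s * rlim u s < 0 -> rlim u t = 0 ->
       0 < omega alpha beta1 s -> 0 < omega alpha beta1 t ->
       positive_on a b (beta1 \- beta2) `[s, t] ->
       changes_sign_in v `[s, t]),
      (llim u s = 0 -> llim u t * rlim u t < 0 ->
       0 < omega alpha beta1 s -> 0 < omega alpha beta1 t ->
       positive_on a b (beta1 \- beta2) `[s, t] ->
       changes_sign_in v `[s, t])
    & (llim u s * rlim u s < 0 -> llim u t * rlim u t < 0 ->
       0 < omega alpha beta1 s -> 0 < omega alpha beta1 t ->
       positive_on a b (beta1 \- beta2) `[s, t] ->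
       changes_sign_in v `[s, t])].
Proof.
have [ab_s ab_t su0 tu0 nzu] : [/\ ointv a b s, ointv a b t,
    llim u s * rlim u s <= 0, llim u t * rlim u t <= 0
  & forall x, s < x < t -> 0 < llim u x * rlim u x].
  case: st => s_t [ab_s su0] [ab_t tu0] noz; split=> // x /andP[sx xt].
  rewrite ltNge; apply/negP => x0.
  have : (zeros u (ointv a b) `&` `]s, t[) x.
    split; last by rewrite /= in_itv /= sx.
    split=> //; split; first by apply: lt_trans ab_s.1 _; rewrite lte_fin.
    by apply: lt_trans ab_t.2; rewrite lte_fin.
  by rewrite noz.
have s_t : s < t by case: st.
have [xu ab_xu uxu] := u_nt; have [xv ab_xv vxv] := v_nt.
(* The compact interval must also contain points where [u] and [v] are nonzero, so that
   nontriviality can be exploited inside it. *)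
have [c [d [cd cl dl]]] : exists c d, [/\ cptsub a b c d,
    c < Num.min s (Num.min xu xv) & Num.max t (Num.max xu xv) < d].
  apply: cptsub_extend.
  - by rewrite !EFin_min !lt_min ab_s.1 ab_xu.1 ab_xv.1.
  - by rewrite ge_min le_max (ltW s_t).
  - by rewrite !EFin_max !gt_max ab_t.2 ab_xu.2 ab_xv.2.
move: cl dl; rewrite !lt_min !gt_max => /and3P[cs cxu cxv] /and3P[td xud xvd].
have inab x : c < x < d -> ointv a b x.
  move=> /andP[cx xd]; case: cd => ac _ db; split.
    by apply: lt_trans ac _; rewrite lte_fin.
  by apply: lt_trans db; rewrite lte_fin.
have alpha_BV := BVloc_increasing alpha_incr.
have ainc := increasing_sides alpha_incr cd.
have gE x y := @gaugeof_increasing _ _ _ _ alpha_incr c d x y cd.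
have [g uS] := solves_of_balanced cd alpha_BV beta1_BV gE u_sol.
have [h vS] := solves_of_balanced cd alpha_BV beta2_BV gE v_sol.
have w1 x : c < x < d -> omg (sides alpha) (sides beta1) x != 0.
  by move=> /inab; exact: omega1_neq0.
have w2 x : c < x < d -> omg (sides alpha) (sides beta2) x != 0.
  by move=> /inab; exact: omega2_neq0.
have uz x : c < x < d -> ~ vanishes (sides u) (sides g) x.
  by apply: (nowhere_vanishes (q := xu) ainc uS w1) => //; rewrite cxu.
have vz x : c < x < d -> ~ vanishes (sides v) (sides h) x.
  by apply: (nowhere_vanishes (q := xv) ainc vS w2) => //; rewrite cxv.
have scd : c < s < d by rewrite cs (lt_trans s_t).
have tcd : c < t < d by rewrite td (lt_trans cs).
(* The five cases differ only in [I], in the alternative taken at each endpoint, and in the endpoint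
   that provides strictness. *)
have key (I : set R) : `]s, t[ `<=` I -> positive_on a b (beta1 \- beta2) I ->
    rlim u s = 0 \/ (0 < omega alpha beta1 s /\ I s) ->
    llim u t = 0 \/ (0 < omega alpha beta1 t /\ I t) ->
    llim u s * rlim u s < 0 \/ llim u t * rlim u t < 0 ->
    changes_sign_in v I.
  move=> stI pos es et strict; apply: contrapT => nchange.
  have nsw x : I x -> ~ switches (sides v) x.
    by move=> Ix /switches_changes_sign vx; apply: nchange; exists x.
  have inI x : s < x < t -> I x by move=> sxt; apply: stI; rewrite /= in_itv.
  have jI x : c < x < d -> I x -> jmp (sides beta2) x <= jmp (sides beta1) x.
    exact: (positive_on_jmp cd beta1_BV beta2_BV pos).
  have := sturm_comparison ainc uS vS w1 w2 uz vz cs s_t td.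
  apply => //.
  - move=> x y sx xy yt; have cx := lt_le_trans cs sx.
    have yd := le_lt_trans yt td.
    apply: (positive_on_inc cd beta1_BV beta2_BV pos cx xy yd).
    move=> z; rewrite /= in_itv /= => /andP[xz zy]; apply: inI.
    by rewrite (le_lt_trans sx xz) (lt_le_trans zy yt).
  - move=> x sxt; apply: jI; last exact: inI.
    by case/andP: sxt => sx xt; rewrite (lt_trans cs sx) (lt_trans xt td).
  - by move=> x /inI; exact: nsw.
  - case: es => [us|[ws Is]]; [by left|right; split=> //].
      exact: jI.
    exact: nsw.
  - case: et => [ut|[wt It]]; [by left|right; split=> //].
      exact: jI.
    exact: nsw.
have Iss : `[s, t]%classic s by rewrite /= in_itv /= lexx ltW.
have Itt : `[s, t]%classic t by rewrite /= in_itv /= lexx ltW.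
split.
- move=> us ut ws pos; apply: key pos _ _ _; [|right|left|left] => //.
    exact: subset_itv_oo_co.
  by split=> //; rewrite /= in_itv /= lexx s_t.
- move=> us ut wt pos; apply: key pos _ _ _; [|left|right|right] => //.
    exact: subset_itv_oo_oc.
  by split=> //; rewrite /= in_itv /= lexx s_t.
(* It is the outer limit of [u] that vanishes at [t], so [t] takes the alternative with omega, its
   product of limits being at most 0; strictness comes from [s]. The next case is symmetric. *)
- move=> us ut ws wt pos; apply: key pos _ _ _; [|right|right|left] => //.
  exact: subset_itv_oo_cc.
- move=> us ut ws wt pos; apply: key pos _ _ _; [|right|right|right] => //.
  exact: subset_itv_oo_cc.
- move=> us ut ws wt pos; apply: key pos _ _ _; [|right|right|left] => //.
  exact: subset_itv_oo_cc.
Qed.
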